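(* Let $K\subset\mathbb{R}^2$ be a convex domain (not necessarily symmetric) with a circle of critical triangles of area $A$. Then $$\operatorname{area}(K)\le \frac{4\pi A}{\sqrt{27}},$$ with equality for, and only for, an ellipse (that is, equality holds if and only if $K$ is an ellipse).
   Context: A convex domain is a compact convex subset of $\mathbb{R}^2$ with nonempty interior; ''ellipse'' means the closed region bounded by an ellipse. A triangle is inscribed in $K$ if its vertices lie on the boundary of $K$. A critical triangle of $K$ is a triangle inscribed in $K$ having maximal area among all triangles inscribed in $K$. For $\theta\in\mathbb{R}$ let $\mathbf{u}_\theta=(\cos\theta,\sin\theta)$, $h(\theta)=\max_{\mathbf{x}\in K}\langle\mathbf{x},\mathbf{u}_\theta\rangle$, and let $L(\theta)=\{\mathbf{x}\in\mathbb{R}^2:\langle\mathbf{x},\mathbf{u}_\theta\rangle=h(\theta)\}$ be the support line. A triangle $\mathbf{x}\mathbf{y}\mathbf{z}$ inscribed in $K$ is anchored at $L(\theta)$ if $\mathbf{x}\in L(\theta)$, the side $\mathbf{y}\mathbf{z}$ is parallel to $L(\theta)$, and its area is maximal among all inscribed triangles with these two properties. $K$ has a circle of critical triangles if each support line $L(\theta)$ of $K$ anchors a critical triangle, i.e. for every $\theta$ there is a critical triangle of $K$ anchored at $L(\theta)$. (By an observation of Genin and Tabachnikov this is equivalent to: each point of the boundary of $K$ lies on an outer billiard triangle, i.e. a triangle circumscribed about $K$ such that the midpoint of each of its sides is on the boundary of $K$.) The number $A$ is the common area of the critical triangles of $K$. *)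

(* Defs.v *)
From HB Require Import structures.
From mathcomp Require Import all_boot all_order all_algebra.
From mathcomp Require Import all_classical all_reals all_analysis.

Set Implicit Arguments.
Unset Strict Implicit.
Unset Printing Implicit Defensive.

Import Order.TTheory GRing.Theory Num.Theory.
Import numFieldNormedType.Exports.

Local Open Scope classical_set_scope.
Local Open Scope ring_scope.

Section Plane.
Context {R : realType}.

Definition dot (p q : R * R) : R := p.1 * q.1 + p.2 * q.2.

Definition unit_dir (theta : R) : R * R := (cos theta, sin theta).

Definition area (K : set (R * R)) : \bar R :=
  ((@lebesgue_measure R) \x (@lebesgue_measure R))%E K.

Definition boundary (K : set (R * R)) : set (R * R) :=
  closure K `\` interior K.

(* The ascription to R^o * R^o selects the R-module structure of the plane. *)
Definition convex_domain (K : set (R * R)) : Prop :=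
  [/\ convex_set (K : set (convex_lmodType (R^o * R^o)%type)),
      compact K & interior K !=set0].

(* The closed region bounded by the ellipse with centre c, semi-axes a and b,
   and principal directions at angles phi and phi + pi/2. *)
Definition ellipse (K : set (R * R)) : Prop :=
  exists (c : R * R) (phi a b : R), [/\ 0 < a, 0 < b &
    K = [set p | (dot (p - c) (unit_dir phi) / a) ^+ 2
               + (dot (p - c) (unit_dir (phi + pi / 2)) / b) ^+ 2 <= 1]].

Definition triangle_area (x y z : R * R) : R :=
  `| (y.1 - x.1) * (z.2 - x.2) - (y.2 - x.2) * (z.1 - x.1) | / 2.

(* Triangles are nondegenerate: collinear triples of points are excluded. *)
Definition inscribed (K : set (R * R)) (x y z : R * R) : Prop :=
  0 < triangle_area x y z /\ [/\ boundary K x, boundary K y & boundary K z].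

Definition critical_triangle (K : set (R * R)) (x y z : R * R) : Prop :=
  inscribed K x y z /\
  forall x' y' z', inscribed K x' y' z' ->
    triangle_area x' y' z' <= triangle_area x y z.

(* For compact nonempty K this supremum is a maximum. *)
Definition support (K : set (R * R)) (theta : R) : R :=
  sup [set dot p (unit_dir theta) | p in K].

Definition support_line (K : set (R * R)) (theta : R) : set (R * R) :=
  [set p | dot p (unit_dir theta) = support K theta].

(* The first vertex is on the support line and the side joining the other two
   is parallel to it, i.e. orthogonal to its normal vector. *)
Definition anchorable (K : set (R * R)) (theta : R) (x y z : R * R) : Prop :=
  [/\ inscribed K x y z, support_line K theta x &
      dot (y - z) (unit_dir theta) = 0].

Definition anchored (K : set (R * R)) (theta : R) (x y z : R * R) : Prop :=
  anchorable K theta x y z /\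
  forall x' y' z', anchorable K theta x' y' z' ->
    triangle_area x' y' z' <= triangle_area x y z.

Definition circle_of_critical_triangles (K : set (R * R)) : Prop :=
  forall theta : R, exists x y z : R * R,
    critical_triangle K x y z /\ anchored K theta x y z.

End Plane.

(* Main.v *)
Require Import Defs.
From HB Require Import structures.
From mathcomp Require Import all_boot all_order all_algebra.
From mathcomp Require Import all_classical all_reals all_analysis.
From mathcomp Require Import ring lra.
Import Order.TTheory GRing.Theory Num.Theory.
Import numFieldNormedType.Exports.
Local Open Scope classical_set_scope.
Local Open Scope ring_scope.

(** The inequality is the averaging argument of Sas. Project [K] on the first
    axis, onto [c - w, c + w], and let [f] and [g] be the concave upper and
    the convex lower boundary functions. The angle [t] parametrizes the
    boundary by [P t = (c + w cos t, Y t)], where [Y] follows [f] when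
    [sin t >= 0] and [g] otherwise. The substitution [x = c + w cos t] turns the
    area of [K] into [w] times the integral of [Y sin] over a period, while the
    triangle with vertices at [t], [t + 2 pi / 3], [t - 2 pi / 3] has signed area
    [sqrt 3 / 2 * w] times the sum of [Y sin] over these three angles. Hence the
    mean of the areas of these inscribed triangles is exactly
    [sqrt 27 / (4 pi)] times the area of [K], and this mean is at most [A]
    ([area_average]).

    In the case of equality all these triangles have the maximal area [A]
    ([Y sin] is continuous even if [Y] jumps at a vertical side of [K]). Moving
    one vertex along the boundary while the others stay fixed cannot increase
    the area; therefore the tangent at [P t] is parallel to the opposite side,
    which reads [Y' t = (Y (t + 2 pi / 3) - Y (t - 2 pi / 3)) / sqrt 3]
    ([is_derive_supported]). It follows that the sums of [Y] and of [Y cos] over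
    the three angles have derivative zero; the sum of [Y sin] is constant by
    assumption. As the vectors [(1, 1, 1)], [(cos t_i)], [(sin t_i)] are
    orthogonal, these three constants determine
    [Y t = (S + 2 B cos t + 2 M sin t) / 3] ([supported_trigonometric]).
    The relation for [Y'] fails a priori where one of the three angles is [0] or
    [pi], so the constants could change at the multiples of [pi / 3]; continuity
    of [f] at the angles [pi / 3] and [2 pi / 3] shows that they do not
    ([extremal_arcs_trigonometric]). The curve so obtained is a sheared ellipse,
    that is, an ellipse ([ellipseP]).

    Conversely, for an ellipse the triangles above all have area
    [3 sqrt 3 / 4] times the product [w k] of the shear parameters, and the
    Weitzenboeck inequality in the unit disc shows that this is the maximal
    area ([triangle_in_sheared_ellipse]). Then the mean equals [A]. *)

Set Implicit Arguments.
Unset Strict Implicit.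
Unset Printing Implicit Defensive.

(** * Calculus on the line *)

Lemma continuous_antiderivative (R : realType) (h : R -> R) (a : R) :
  continuous h -> exists H : R -> R, forall x, a < x -> is_derive x 1 H (h x).
Proof.
move=> ch.
exists (fun x => \int[lebesgue_measure]_(t in `[a, x]) h t)%R => x ax.
have xu : x < x + 1 by rewrite ltrDl.
have hi : lebesgue_measure.-integrable `[a, x + 1] (EFin \o h).
  apply: continuous_compact_integrable; first exact: segment_compact.
  exact: continuous_subspaceT.
have [dH H'E] := continuous_FTC1_closed xu hi ax (ch x).
by apply: DeriveDef => //; rewrite -H'E derive1E.
Qed.

Lemma is_derive_continuous (R : realType) (h : R -> R) (x d : R) :
  is_derive x 1 h d -> {for x, continuous h}.
Proof.
by move=> [dh _]; apply: differentiable_continuous; apply/derivable1_diffP.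
Qed.

Lemma within_continuous_is_derive (R : realType) (H h : R -> R) (A : set R) :
  (forall x, A x -> is_derive x 1 H (h x)) -> {within A, continuous H}.
Proof.
move=> dH; apply: continuous_in_subspaceT => x /set_mem Ax.
exact: is_derive_continuous (dH x Ax).
Qed.

Lemma continuous_integral_antiderivative (R : realType) (h H : R -> R) (a b : R) :
  a < b -> continuous h ->
  (forall x, a <= x <= b -> is_derive x 1 H (h x)) ->
  (\int[lebesgue_measure]_(x in `[a, b]) (h x)%:E = (H b - H a)%:E)%E.
Proof.
move=> ab ch dH.
rewrite EFinB; apply: continuous_FTC2 => //.
- exact: continuous_subspaceT.
- split.
  + by move=> x; rewrite in_itv/= => /andP[ax xb]; have [] := dH x; rewrite ?ltW.
  + apply: cvg_at_right_filter; apply: (@is_derive_continuous _ _ _ (h a)).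
    by apply: dH; rewrite lexx ltW.
  + apply: cvg_at_left_filter; apply: (@is_derive_continuous _ _ _ (h b)).
    by apply: dH; rewrite lexx ltW.
- move=> x; rewrite in_itv/= => /andP[ax xb]; rewrite derive1E.
  by have [|_ ->] := dH x; rewrite ?ltW.
Qed.

Lemma is_derive_shift (R : realType) (h : R -> R) (d c t : R) :
  is_derive (t + c) 1 h d -> is_derive t 1 (fun u => h (u + c)) d.
Proof.
move=> dh.
have tc : is_derive t 1 (fun u : R => u + c) (1 + 0) by apply: is_deriveD.
by have := @is_derive1_comp _ h (fun u => u + c) _ _ _ dh tc; rewrite addr0 mulr1.
Qed.

Lemma is_derive_reflect (R : realType) (h : R -> R) (d c t : R) :
  is_derive (c - t) 1 h d -> is_derive t 1 (fun u => h (c - u)) (- d).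
Proof.
move=> dh.
have tc : is_derive t 1 (fun u : R => c - u) (0 - 1) by apply: is_deriveB.
by have := @is_derive1_comp _ h (fun u => c - u) _ _ _ dh tc; rewrite add0r mulrN mulr1.
Qed.

(** A nondecreasing function that takes the same value at both ends is constant;
    this is how equality of two means becomes equality at every angle. *)
Lemma nondecreasing_eq_ends (R : realType) (N n : R -> R) (a b : R) :
  a < b -> (forall x, a <= x <= b -> is_derive x 1 N (n x)) ->
  (forall x, a < x < b -> 0 <= n x) ->
  N a <= N b /\ (N a = N b <-> forall x, a < x < b -> n x = 0).
Proof.
move=> ab dN n0.
have wN : {within `[a, b], continuous N}.
  apply: (@within_continuous_is_derive _ _ n) => x; rewrite /= in_itv/=; exact: dN.
have doo x : x \in `]a, b[ -> is_derive x 1 N (n x).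
  by rewrite in_itv/= => /andP[ax xb]; apply: dN; rewrite !ltW.
have mono x y : a <= x -> x <= y -> y <= b -> N x <= N y.
  move=> ax xy yb; apply: (@ger0_derive1_le_cc _ N a b) => //.
  - by move=> z /doo[].
  - by move=> z zab; rewrite derive1E; have [_ ->] := doo z zab; exact: n0.
  - by rewrite in_itv/= ax (le_trans xy).
  - by rewrite in_itv/= yb (le_trans ax).
split; first exact: (mono _ _ (lexx a) (ltW ab) (lexx b)).
split=> [Nab x xab|n00].
  have xoo : x \in `]a, b[ by rewrite in_itv.
  have [ax xb] := andP xab.
  have Nc t : a <= t -> t <= b -> N t = N a.
    by move=> ta tb; apply/le_anti; rewrite (mono a)// andbT Nab mono.
  have [_ N'0] : is_derive x 1 N 0.
    apply: (derive1_at_min (ltW ab) _ xoo) => [t /doo[]//|t].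
    by rewrite in_itv/= => /andP[? ?]; rewrite !Nc// ltW.
  by rewrite -N'0; have [_ ->] := doo x xoo.
have [x xab /eqP] := MVT ab doo wN.
by rewrite n00// mul0r subr_eq0 => /eqP.
Qed.

(** Stated on an open interval because the conserved sums below are
    differentiable only strictly between two exceptional angles. *)
Lemma is_derive_0_oo_cst (R : realType) (h : R -> R) (p q : R) :
  (forall x, p < x < q -> is_derive x 1 h 0) ->
  forall x y, p < x < q -> p < y < q -> h x = h y.
Proof.
move=> dh.
suff wl x y : p < x -> x < y -> y < q -> h x = h y.
  move=> x y /andP[px xq] /andP[py yq].
  by case: (ltgtP x y) => [xy|yx|->//]; [exact: wl|exact/esym/wl].
move=> px xy yq.
have dh' z : x <= z <= y -> is_derive z 1 h 0.
  by move=> /andP[xz zy]; apply: dh; rewrite (lt_le_trans px)// (le_lt_trans zy).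
have [//|_ eq] := nondecreasing_eq_ends (n := fun=> 0) xy dh'.
by apply/eq.
Qed.

(** With [al] a third of the period, the integral of [E] over a period is the
    integral over [(0, al)] of the sum of three translates of [E]. Phrased with
    the antiderivative [Phi], the statement needs no change of variables: it
    compares [M t] with [Phi t + Phi (t + al) + Phi (t + 2 al)]. The bound [-1]
    stands for any base point to the left of [0]: an integral is differentiable
    in its upper end only to the right of its lower end. *)
Lemma sum_of_translates_average (R : realType) (E Phi : R -> R) (al M : R) :
  0 < al -> (forall t : R, -1 < t -> is_derive t 1 Phi (E t)) ->
  (forall t, 0 < t < al -> E t + E (t + al) + E (t + 2 * al) <= M) ->
  Phi (3 * al) - Phi 0 <= M * al /\
  (Phi (3 * al) - Phi 0 = M * al <->
   forall t, 0 < t < al -> E t + E (t + al) + E (t + 2 * al) = M).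
Proof.
move=> al0 dPhi EM.
pose N t := M * t - (Phi t + Phi (t + al) + Phi (t + 2 * al)).
pose n t := M - (E t + E (t + al) + E (t + 2 * al)).
have dN t : 0 <= t <= al -> is_derive t 1 N (n t).
  move=> /andP[t0 _].
  have d c : 0 <= c -> is_derive t 1 (fun u => Phi (u + c)) (E (t + c)).
    by move=> c0; apply: is_derive_shift; apply: dPhi; lra.
  have d0 : is_derive t 1 Phi (E t) by apply: dPhi; lra.
  have d1 := d al (ltW al0).
  have d2 : is_derive t 1 (fun u => Phi (u + 2 * al)) (E (t + 2 * al)).
    by apply: d; rewrite mulr_ge0// ltW.
  have dM : is_derive t 1 (fun u : R => M * u) (M * 1) by apply: is_deriveZ.
  have := is_deriveB dM (is_deriveD (is_deriveD d0 d1) d2).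
  by rewrite mulr1.
have [|le eq] := nondecreasing_eq_ends al0 dN.
  by move=> t /EM; rewrite subr_ge0.
have E0 : N al - N 0 = M * al - (Phi (3 * al) - Phi 0).
  rewrite /N !add0r mulr0 add0r.
  have -> : al + al = 2 * al by ring.
  have -> : al + 2 * al = 3 * al by ring.
  ring.
split; first by rewrite -subr_ge0 -E0 subr_ge0.
split=> [h t tal|h].
  have /eq/(_ t tal) : N 0 = N al by lra.
  by move/eqP; rewrite subr_eq0 => /eqP <-.
have /eq : forall x, 0 < x < al -> n x = 0 by move=> t /h; rewrite /n => ->; rewrite subrr.
lra.
Qed.

(** The hypothesis bounds the error of the first order expansion of [h] in
    terms of [k] by the oscillation of the slope [l] itself. Two supporting
    lines, one at [s] and one at [t], give such a bound, and continuity of [l]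
    then upgrades it to differentiability. *)
Lemma is_derive_subgradient (R : realType) (h k l : R -> R) (t dk : R) :
  is_derive t 1 k dk -> {for t, continuous l} ->
  (\forall s \near t, `|h s - h t - l t * (k s - k t)| <= `|k s - k t| * `|l s - l t|) ->
  is_derive t 1 h (l t * dk).
Proof.
move=> [dkt kE] cl hl.
pose q (F : R -> R) (e : R) : R := e^-1 *: (F (e *: 1 + t) - F t).
have qk : q k e @[e --> 0^'] --> dk by rewrite -kE; exact: dkt.
have tow : e *: (1 : R) + t @[e --> (0 : R)^'] --> t.
  rewrite -[X in _ --> X]add0r -[X in _ --> X + _](scale0r (1 : R)).
  apply: cvg_within_filter; apply: cvgD; last exact: cvg_cst.
  by apply: cvgZr_tmp; exact: cvg_id.
have err0 : `|q k e| * `|l (e *: 1 + t) - l t| @[e --> 0^'] --> (0 : R).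
  suff : `|q k e| * `|l (e *: 1 + t) - l t| @[e --> 0^'] --> `|dk| * `|l t - l t|.
    by rewrite subrr normr0 mulr0.
  apply: cvgM; first exact: cvg_norm.
  apply: cvg_norm; apply: cvgB; last exact: cvg_cst.
  exact: (cvg_comp _ _ tow cl).
have qh : q h e - l t * q k e @[e --> 0^'] --> (0 : R).
  apply/norm_cvg0P.
  apply: (squeeze_cvgr _ (cvg_cst 0) err0).
  near=> e; rewrite normr_ge0/=.
  have -> : q h e - l t * q k e =
      e^-1 * (h (e *: 1 + t) - h t - l t * (k (e *: 1 + t) - k t)).
    by rewrite /q /GRing.scale/=; ring.
  rewrite normrM /q /GRing.scale/= normrM -mulrA ler_wpM2l//.
  by near: e; exact: (tow _ hl).
have qhl : q h e @[e --> 0^'] --> l t * dk.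
  have : q h e - l t * q k e + l t * q k e @[e --> 0^'] --> 0 + l t * dk.
    by apply: cvgD => //; apply: cvgM => //; exact: cvg_cst.
  by rewrite add0r; under eq_fun do rewrite subrK.
apply: DeriveDef; first by apply: cvgP qhl.
exact: (cvg_lim _ qhl).
Unshelve. all: by end_near. Qed.

Lemma eq_at_ends (R : realType) (h k : R -> R) (p q : R) :
  p < q -> continuous h -> continuous k ->
  (forall x, p < x < q -> h x = k x) -> h p = k p /\ h q = k q.
Proof.
move=> pq ch ck hk; split.
  have h1 : h x @[x --> p^'+] --> h p by apply: cvg_at_right_filter; exact: ch.
  have k1 : k x @[x --> p^'+] --> k p by apply: cvg_at_right_filter; exact: ck.
  apply: (cvg_unique (@Rhausdorff R) h1); apply: cvg_trans k1; apply: near_eq_cvg.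
  near=> x; apply/esym/hk/andP; split; near: x; first exact: nbhs_right_gt.
  exact: nbhs_right_lt.
have h1 : h x @[x --> q^'-] --> h q by apply: cvg_at_left_filter; exact: ch.
have k1 : k x @[x --> q^'-] --> k q by apply: cvg_at_left_filter; exact: ck.
apply: (cvg_unique (@Rhausdorff R) h1); apply: cvg_trans k1; apply: near_eq_cvg.
near=> x; apply/esym/hk/andP; split; near: x; last exact: nbhs_left_lt.
exact: nbhs_left_gt.
Unshelve. all: by end_near. Qed.

(** * Trigonometry of the angle 2 pi / 3 *)

Lemma cos_pi3 (R : realType) : cos (pi / 3) = 1 / 2 :> R.
Proof.
have s0 : 0 < sin (pi / 3 : R).
  by apply: sin_gt0_pi; rewrite divr_gt0 ?pi_gt0//= ltr_pdivrMr ?ltr0n// ltr_pMr ?pi_gt0 ?ltr1n.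
(* The angles pi / 3 and 2 pi / 3 are supplementary. *)
have : sin (pi / 3) = sin (pi / 3 *+ 2) :> R.
  by rewrite -[LHS]opprK -sinN -sinDpi mulr2n; congr sin; field.
rewrite sin_mulr2n mulr2n => h.
by apply: (mulIf (lt0r_neq0 s0)); lra.
Qed.

Lemma sin_pi3 (R : realType) : sin (pi / 3) = Num.sqrt 3 / 2 :> R.
Proof.
have s0 : 0 < sin (pi / 3 : R).
  by apply: sin_gt0_pi; rewrite divr_gt0 ?pi_gt0//= ltr_pdivrMr ?ltr0n// ltr_pMr ?pi_gt0 ?ltr1n.
have := cos2Dsin2 (pi / 3 : R); rewrite cos_pi3 => h.
have h3 : 3 = (2 * sin (pi / 3 : R)) ^+ 2 by rewrite exprMn; lra.
have -> : Num.sqrt 3 = 2 * sin (pi / 3 : R).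
  by rewrite [in LHS]h3 sqrtr_sqr gtr0_norm ?mulr_gt0.
by field.
Qed.

Lemma cos_2pi3 (R : realType) : cos (2 * pi / 3) = - (1 / 2) :> R.
Proof.
have -> : 2 * pi / 3 = - (pi / 3) + pi :> R by field.
by rewrite cosDpi cosN cos_pi3.
Qed.

Lemma sin_2pi3 (R : realType) : sin (2 * pi / 3) = Num.sqrt 3 / 2 :> R.
Proof.
have -> : 2 * pi / 3 = - (pi / 3) + pi :> R by field.
by rewrite sinDpi sinN opprK sin_pi3.
Qed.

Lemma sqrt3_sq (R : realType) : Num.sqrt 3 * Num.sqrt 3 = 3 :> R.
Proof. by rewrite -expr2 sqr_sqrtr// ler0n. Qed.

Lemma sqrt3_gt0 (R : realType) : 0 < Num.sqrt 3 :> R.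
Proof. by rewrite sqrtr_gt0 ltr0n. Qed.

Lemma sqrt27 (R : realType) : Num.sqrt 27 = 3 * Num.sqrt 3 :> R.
Proof.
have -> : 27 = 3 ^+ 2 * 3 :> R by ring.
by rewrite sqrtrM ?exprn_ge0// sqrtr_sqr ger0_norm.
Qed.

Lemma cosD2pi3 (R : realType) (t : R) :
  cos (t + 2 * pi / 3) = - (cos t / 2) - Num.sqrt 3 / 2 * sin t.
Proof. rewrite cosD cos_2pi3 sin_2pi3; by field. Qed.

Lemma sinD2pi3 (R : realType) (t : R) :
  sin (t + 2 * pi / 3) = - (sin t / 2) + Num.sqrt 3 / 2 * cos t.
Proof. rewrite sinD cos_2pi3 sin_2pi3; by field. Qed.

Lemma cosB2pi3 (R : realType) (t : R) :
  cos (t - 2 * pi / 3) = - (cos t / 2) + Num.sqrt 3 / 2 * sin t.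
Proof. rewrite cosB cos_2pi3 sin_2pi3; by field. Qed.

Lemma sinB2pi3 (R : realType) (t : R) :
  sin (t - 2 * pi / 3) = - (sin t / 2) - Num.sqrt 3 / 2 * cos t.
Proof. rewrite sinB cos_2pi3 sin_2pi3; by field. Qed.

(** * The angular parameter and the mean area of inscribed triangles *)

(** Height of the boundary point with angle [t]: the counterclockwise walk runs
    along the graph of [f] for [0 <= t <= pi] and back along that of [g]. It
    jumps at [0] or [pi] if the region has a vertical side there. *)
Definition arc_height (R : realType) (f g : R -> R) (c w t : R) : R :=
  if 0 <= sin t then f (c + w * cos t) else g (c + w * cos t).

Lemma continuous_abscissa (R : realType) (c w : R) :
  continuous (fun t : R => c + w * cos t).
Proof.
move=> t; apply: cvgD; first exact: cvg_cst.
apply: cvgM; first exact: cvg_cst.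
exact: continuous_cos.
Qed.

Lemma continuous_comp_abscissa (R : realType) (h : R -> R) (c w : R) :
  continuous h -> continuous (fun t => h (c + w * cos t)).
Proof.
by move=> ch t; exact: (continuous_comp (@continuous_abscissa R c w t) (ch _)).
Qed.

Lemma is_derive_abscissa (R : realType) (c w t : R) :
  is_derive t 1 (fun u : R => c + w * cos u) (- (w * sin t)).
Proof.
have := is_deriveD (is_derive_cst c t 1) (is_deriveZ w (is_derive_cos t)).
by rewrite add0r -mulrN.
Qed.

Lemma periodic_arc_height (R : realType) (f g : R -> R) (c w : R) :
  periodic (arc_height f g c w) (2 * pi).
Proof. by move=> t; rewrite /arc_height mulr_natl sinD2pi cosD2pi. Qed.

Lemma continuous_arc_height (R : realType) (f g : R -> R) (c w t : R) :
  continuous f -> continuous g -> sin t != 0 ->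
  {for t, continuous (arc_height f g c w)}.
Proof.
move=> cf cg; set Y := arc_height f g c w.
have cs : sin u @[u --> t] --> sin t by exact: continuous_sin.
rewrite neq_lt => /orP[s0|s0].
  have Yt : Y t = g (c + w * cos t) by rewrite /Y /arc_height leNgt s0.
  suff : Y u @[u --> t] --> g (c + w * cos t) by rewrite -Yt.
  have cX : g (c + w * cos u) @[u --> t] --> g (c + w * cos t).
    exact: continuous_comp_abscissa.
  apply: cvg_trans cX; apply: near_eq_cvg; near=> u.
  rewrite /Y /arc_height leNgt (_ : sin u < 0)//; near: u.
  by move/cvgr_lt : cs; apply.
have Yt : Y t = f (c + w * cos t) by rewrite /Y /arc_height ltW.
suff : Y u @[u --> t] --> f (c + w * cos t) by rewrite -Yt.
have cX : f (c + w * cos u) @[u --> t] --> f (c + w * cos t).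
  exact: continuous_comp_abscissa.
apply: cvg_trans cX; apply: near_eq_cvg; near=> u.
rewrite /Y /arc_height ltW//; near: u.
by move/cvgr_gt : cs; apply.
Unshelve. all: by end_near. Qed.

(** The factor [sin t] vanishes exactly where the height may jump, so the
    product is continuous at every angle. *)
Lemma continuous_arc_height_sin (R : realType) (f g : R -> R) (c w : R) :
  continuous f -> continuous g ->
  continuous (fun t => arc_height f g c w t * sin t).
Proof.
move=> cf cg.
have -> : (fun t => arc_height f g c w t * sin t) =
          (fun t => f (c + w * cos t) * ((sin t + `|sin t|) / 2) +
                    g (c + w * cos t) * ((sin t - `|sin t|) / 2)).
  apply/funext => t; rewrite /arc_height; case: ifPn => [s0|].
    by rewrite ger0_norm//; field.
  by rewrite -ltNge => s0; rewrite ltr0_norm//; field.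
have cn (t : R) : `|sin u| @[u --> t] --> `|sin t|.
  by apply: cvg_norm; exact: continuous_sin.
have cs (t : R) : sin u @[u --> t] --> sin t by exact: continuous_sin.
move=> t; apply: cvgD; apply: cvgM.
- exact: continuous_comp_abscissa.
- by apply: cvgM; [apply: cvgD; [exact: cs|exact: cn]|exact: cvg_cst].
- exact: continuous_comp_abscissa.
- by apply: cvgM; [apply: cvgB; [exact: cs|exact: cn]|exact: cvg_cst].
Qed.

(** Fubini, read off the definition of the product measure: the vertical
    sections are segments. *)
Lemma area_between_graphs (R : realType) (K : set (R * R)) (f g : R -> R) (a b : R) :
  (forall p, K p <-> a <= p.1 <= b /\ g p.1 <= p.2 <= f p.1) ->
  (forall x, a <= x <= b -> g x <= f x) ->
  area K = (\int[lebesgue_measure]_(x in `[a, b]) (f x - g x)%:E)%E.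
Proof.
move=> KE gf; rewrite /area /product_measure1 [RHS]integral_mkcond/=.
apply: eq_integral => x _ /=; rewrite patchE.
case: ifPn => [/set_mem|/negP xab].
  rewrite /= in_itv/= => xab.
  have -> : xsection K x = `[g x, f x]%classic.
    apply/seteqP; split => y; rewrite /= in_itv/=.
      by move/xsectionP/KE => [].
    by move=> xy; apply/xsectionP/KE.
  by rewrite lebesgue_measure_itv/= lte_fin; have := gf x xab;
     rewrite le_eqVlt => /orP[/eqP ->|->//]; rewrite ltxx subrr.
suff -> : xsection K x = set0 by rewrite measure0.
apply/seteqP; split => // y /xsectionP/KE[/= xab' _]; apply: xab.
by apply/mem_set; rewrite /= in_itv.
Qed.

(** The substitution [x = c + w cos t]. The upper arc at [t] and the lower arc
    at [2 pi - t] lie on the same vertical line, and the function [N] of the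
    proof, which combines the two antiderivatives, has derivative zero. *)
Lemma area_from_arcs (R : realType) (K : set (R * R)) (f g Phi : R -> R) (c w : R) :
  0 < w -> continuous f -> continuous g ->
  (forall p, K p <-> c - w <= p.1 <= c + w /\ g p.1 <= p.2 <= f p.1) ->
  (forall x, c - w <= x <= c + w -> g x <= f x) ->
  (forall t : R, -1 < t -> is_derive t 1 Phi (arc_height f g c w t * sin t)) ->
  area K = (w * (Phi (2 * pi) - Phi 0))%:E.
Proof.
move=> w0 cf cg KE gf dPhi.
have ch : continuous (fun x => f x - g x).
  by move=> x; apply: cvgB; [exact: cf|exact: cg].
have [G dG] := continuous_antiderivative (c - w - 1) ch.
have cww : c - w < c + w by lra.
have dG' x : c - w <= x <= c + w -> is_derive x 1 G (f x - g x).
  by move=> /andP[cx _]; apply: dG; lra.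
rewrite (area_between_graphs KE gf) (continuous_integral_antiderivative cww ch dG').
congr (_%:E).
pose N t := w * (Phi t - Phi (2 * pi - t)) + G (c + w * cos t).
pose n t := w * (arc_height f g c w t * sin t +
                 arc_height f g c w (2 * pi - t) * sin (2 * pi - t)) -
            (f (c + w * cos t) - g (c + w * cos t)) * (w * sin t).
have dN t : 0 <= t <= pi -> is_derive t 1 N (n t).
  move=> /andP[t0 tpi].
  have d1 : is_derive t 1 Phi (arc_height f g c w t * sin t) by apply: dPhi; lra.
  have d2 := is_derive_reflect (dPhi (2 * pi - t) ltac:(lra)).
  have d3 : is_derive (c + w * cos t) 1 G (f (c + w * cos t) - g (c + w * cos t)).
    have : -1 <= cos t := cos_geN1 t.
    by move=> ct; apply: dG; nra.
  have := is_deriveD (is_deriveZ w (is_deriveB d1 d2))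
                     (@is_derive1_comp _ G (fun u => c + w * cos u) _ _ _ d3
                         (is_derive_abscissa c w t)).
  by rewrite opprK mulrN.
have n0 t : 0 < t < pi -> n t = 0.
  move=> /sin_gt0_pi st; rewrite /n /arc_height.
  have -> : 2 * pi - t = - t + pi *+ 2 by rewrite mulr2n; ring.
  rewrite sinD2pi cosD2pi sinN cosN (ltW st) oppr_ge0 leNgt st/=; ring.
have [|_ [_ /(_ n0)]] := nondecreasing_eq_ends (pi_gt0 R) dN.
  by move=> t /n0 ->.
rewrite /N cos0 cospi subr0.
have -> : 2 * pi - pi = pi :> R by ring.
rewrite mulr1 mulrN1; lra.
Qed.

(** The identity of Sas in the form that is used: a bound [M] on the sum [T t],
    which is a constant multiple of the area of an inscribed triangle, bounds
    the area of [K], and equality forces equality for each [t]. *)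
Lemma area_average (R : realType) (K : set (R * R)) (f g : R -> R) (c w M : R) :
  0 < w -> continuous f -> continuous g ->
  (forall x, c - w <= x <= c + w -> g x <= f x) ->
  (forall p, K p <-> c - w <= p.1 <= c + w /\ g p.1 <= p.2 <= f p.1) ->
  let Y := arc_height f g c w in
  let T t := Y t * sin t + Y (t + 2 * pi / 3) * sin (t + 2 * pi / 3) +
             Y (t - 2 * pi / 3) * sin (t - 2 * pi / 3) in
  (forall t, 0 < t < 2 * pi / 3 -> T t <= M) ->
  (area K <= (2 * pi / 3 * w * M)%:E)%E /\
  (area K = (2 * pi / 3 * w * M)%:E <-> forall t, 0 < t < 2 * pi / 3 -> T t = M).
Proof.
move=> w_gt0 contf contg legf KE Y T TM.
have [Phi dPhi] := continuous_antiderivative (-1)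
  (@continuous_arc_height_sin R f g c w contf contg).
have -> := area_from_arcs w_gt0 contf contg KE legf dPhi.
set a : R := 2 * pi / 3.
have a0 : 0 < a by rewrite /a divr_gt0// mulr_gt0// pi_gt0.
have TE t : T t = Y t * sin t + Y (t + a) * sin (t + a) + Y (t + 2 * a) * sin (t + 2 * a).
  rewrite /T -/a (_ : t + 2 * a = t - a + 2 * pi); last by rewrite /a; field.
  have pY : periodic Y (2 * pi) by exact: periodic_arc_height.
  by rewrite pY mulr_natl sinD2pi.
have [|le eq] := sum_of_translates_average (M := M) a0 dPhi.
  by move=> t ta; rewrite -[leLHS]TE; exact: TM.
have a3 : 3 * a = 2 * pi by rewrite /a; field.
rewrite a3 in le eq; split.
  by rewrite lee_fin -mulrA mulrCA ler_pM2l// [a * M]mulrC.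
split=> [[h] t ta|h].
  rewrite TE; apply: (eq.1 _ t ta); apply: (mulfI (lt0r_neq0 w_gt0)).
  by rewrite h; ring.
congr (_%:E); rewrite (eq.2 _); first by ring.
by move=> t ta; rewrite -TE; exact: h.
Qed.

(** * The case of equality *)

(** Derivative of the height at [t] that makes the tangent parallel to the side
    joining the points at [t + 2 pi / 3] and [t - 2 pi / 3]: from the former to
    the latter the abscissa varies by [w sqrt 3 sin t], and [- w sin t] is the derivative of the
    abscissa at [t]. *)
Definition opposite_slope (R : realType) (Y : R -> R) (t : R) : R :=
  (Y (t + 2 * pi / 3) - Y (t - 2 * pi / 3)) / Num.sqrt 3.

(** The line through the point at [t] parallel to the opposite side supports the
    curve. The inequality is multiplied by [sin t], whose sign tells the upper
    arc from the lower one. *)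
Definition supported_at (R : realType) (Y : R -> R) (t : R) : Prop :=
  forall s, sin t * (Y s - Y t) <= (cos t - cos s) * opposite_slope Y t.

(** Supporting lines of slopes [z / a] and [z' / b] at two points of the same
    arc ([a] and [b] have the same sign) enclose the chord between them. *)
Lemma subgradient_sandwich (R : realType) (a b d z z' e : R) :
  0 < a * b -> a * e <= d * z -> b * - e <= - d * z' ->
  `|e - z / a * d| <= `|d| * `|z' / b - z / a|.
Proof.
move=> ab0 h1 h2.
have a0 : a != 0 by apply: contraTneq ab0 => ->; rewrite mul0r ltxx.
have b0 : b != 0 by apply: contraTneq ab0 => ->; rewrite mulr0 ltxx.
have ea : z = a * (z / a) by field.
have eb : z' = b * (z' / b) by field.
move: h1 h2; rewrite {1}ea {1}eb => {ea eb}.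
set p := z / a; set q := z' / b => h1 h2.
rewrite -normrM ler_norml.
have := ler_norm (d * (q - p)); have := ler_norm (- (d * (q - p))); rewrite normrN.
have [a1|a1] := ltrP 0 a.
  have b1 : 0 < b by rewrite -(pmulr_rgt0 _ a1).
  have h1' : e <= d * p by rewrite -(ler_pM2l a1) (le_trans h1)// mulrCA.
  have h2' : - e <= - d * q by rewrite -(ler_pM2l b1) (le_trans h2)// mulrCA.
  nra.
have {}a1 : a < 0 by rewrite lt_neqAle a0.
have b1 : b < 0 by rewrite -(nmulr_rgt0 _ a1).
have h1' : d * p <= e by rewrite -(ler_nM2l a1) (le_trans h1)// mulrCA.
have h2' : - d * q <= - e by rewrite -(ler_nM2l b1) (le_trans h2)// mulrCA.
nra.
Qed.

Lemma is_derive_supported (R : realType) (Y : R -> R) (t : R) :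
  sin t != 0 -> {for t + 2 * pi / 3, continuous Y} ->
  {for t - 2 * pi / 3, continuous Y} ->
  (\forall s \near t, supported_at Y s) ->
  is_derive t 1 Y (opposite_slope Y t).
Proof.
move=> st0 c1 c2 sup.
have cZ : {for t, continuous (opposite_slope Y)}.
  apply: cvgM; last exact: cvg_cst.
  have shift c : u + c @[u --> t] --> t + c by apply: cvgD => //; exact: cvg_cst.
  by apply: cvgB; [exact: (cvg_comp _ _ (shift _) c1)|exact: (cvg_comp _ _ (shift _) c2)].
have -> : opposite_slope Y t = opposite_slope Y t / sin t * sin t by rewrite divfK.
have dk : is_derive t 1 (fun s : R => - cos s) (sin t).
  by have := is_deriveN (is_derive_cos t); rewrite opprK.
apply: (is_derive_subgradient (l := fun s => opposite_slope Y s / sin s) dk).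
  have cV : (sin s)^-1 @[s --> t] --> (sin t)^-1.
    by apply: cvgV => //; exact: continuous_sin.
  exact: (cvgM cZ cV).
have supt : supported_at Y t := nbhs_singleton sup.
have s2 : \forall s \near t, 0 < sin t * sin s.
  have : sin t * sin s @[s --> t] --> sin t * sin t.
    by apply: cvgM; [exact: cvg_cst|exact: continuous_sin].
  move=> /cvgr_gt; apply.
  by rewrite -expr2 lt_neqAle sqr_ge0 andbT eq_sym expf_eq0.
near=> s.
have ss : supported_at Y s by near: s.
have -> : - cos s - - cos t = cos t - cos s by rewrite opprK addrC.
apply: subgradient_sandwich; first by near: s.
  exact: supt.
by rewrite !opprB; exact: ss.
Unshelve. all: by end_near. Qed.

Definition trigonometric (R : realType) (S B M t : R) : R :=
  (S + 2 * B * cos t + 2 * M * sin t) / 3.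

(** With [t1, t2] the angles [t + 2 pi / 3] and [t - 2 pi / 3], the three
    derivatives are cyclic differences of heights. Hence the sums of [Y] and of
    [Y cos] are constant, and the height is recovered from the sums [S], [B], [M]
    because [1 + 2 cos (t - ti)] vanishes for [i = 1, 2]. *)
Lemma supported_trigonometric (R : realType) (Y : R -> R) (p q M : R) :
  p < q -> periodic Y (2 * pi) ->
  (forall t, sin t != 0 -> {for t, continuous Y}) ->
  (forall t, p < t < q ->
    [/\ sin t != 0, sin (t + 2 * pi / 3) != 0 & sin (t - 2 * pi / 3) != 0]) ->
  (forall t, p < t < q ->
    [/\ supported_at Y t, supported_at Y (t + 2 * pi / 3) &
        supported_at Y (t - 2 * pi / 3)]) ->
  (forall t, p < t < q ->
    Y t * sin t + Y (t + 2 * pi / 3) * sin (t + 2 * pi / 3) +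
    Y (t - 2 * pi / 3) * sin (t - 2 * pi / 3) = M) ->
  exists S B, forall t, p < t < q ->
    [/\ Y t = trigonometric S B M t,
        Y (t + 2 * pi / 3) = trigonometric S B M (t + 2 * pi / 3) &
        Y (t - 2 * pi / 3) = trigonometric S B M (t - 2 * pi / 3)].
Proof.
move=> pq perY cY s0 sup sumM.
set a : R := 2 * pi / 3.
have Ypp t : Y (t + a + a) = Y (t - a).
  by rewrite -(perY (t - a)); congr Y; rewrite /a; field.
have Ymm t : Y (t - a - a) = Y (t + a).
  by rewrite -(perY (t - a - a)); congr Y; rewrite /a; field.
have nearI t (P : R -> Prop) : p < t < q -> (forall s, p < s < q -> P s) ->
    \forall s \near t, P s.
  move=> ptq PI; near=> s; apply: PI; apply/andP; split; near: s.
    by apply: lt_nbhsr; case/andP: ptq.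
  by apply: lt_nbhsl; case/andP: ptq.
have nearS t c (P : R -> Prop) : (\forall s \near t, P (s + c)) ->
    \forall s \near t + c, P s.
  move=> Pc; have h : u - c @[u --> t + c] --> t.
    rewrite -[X in _ --> X](addrK c); apply: cvgB => //; exact: cvg_cst.
  by near=> s; rewrite -(subrK c s); near: s; exact: (h _ Pc).
pose Y0' t := (Y (t + a) - Y (t - a)) / Num.sqrt 3.
pose Y1' t := (Y (t - a) - Y t) / Num.sqrt 3.
pose Y2' t := (Y t - Y (t + a)) / Num.sqrt 3.
have d0 t : p < t < q -> is_derive t 1 Y (Y0' t).
  move=> tI; have [n0 n1 n2] := s0 t tI.
  apply: is_derive_supported; [done|exact: cY|exact: cY|].
  by apply: nearI tI _ => s /sup[].
have d1 t : p < t < q -> is_derive t 1 (fun u => Y (u + a)) (Y1' t).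
  move=> tI; have [n0 n1 n2] := s0 t tI; apply: is_derive_shift.
  have -> : Y1' t = opposite_slope Y (t + a).
    by rewrite /opposite_slope -/a Ypp addrK.
  apply: is_derive_supported => //.
  - apply: cY; have -> : t + a + 2 * pi / 3 = t - a + pi *+ 2.
      by rewrite /a mulr2n; field.
    by rewrite sinD2pi.
  - by rewrite -/a addrK; exact: cY.
  - by apply: nearS; apply: nearI tI _ => s /sup[].
have d2 t : p < t < q -> is_derive t 1 (fun u => Y (u - a)) (Y2' t).
  move=> tI; have [n0 n1 n2] := s0 t tI; apply: is_derive_shift.
  have -> : Y2' t = opposite_slope Y (t - a).
    by rewrite /opposite_slope -/a Ymm subrK.
  apply: is_derive_supported => //.
  - by rewrite -/a subrK; exact: cY.
  - apply: cY; have -> : t - a - 2 * pi / 3 = t + a - pi *+ 2.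
      by rewrite /a mulr2n; field.
    by rewrite -[t + a](subrK (pi *+ 2)) sinD2pi in n1.
  - by apply: nearS; apply: nearI tI _ => s /sup[].
have s3 := sqrt3_gt0 R; have s33 := sqrt3_sq R.
have r3V : (Num.sqrt 3)^-1 = Num.sqrt 3 / 3 :> R by field: s33; exact: lt0r_neq0.
have [SS ES] : exists S, forall t, p < t < q -> Y t + Y (t + a) + Y (t - a) = S.
  have h t : p < t < q ->
      is_derive t 1 (fun u => Y u + Y (u + a) + Y (u - a)) 0.
    move=> tI.
    have -> : 0 = Y0' t + Y1' t + Y2' t by rewrite /Y0' /Y1' /Y2'; ring.
    exact: (is_deriveD (is_deriveD (d0 t tI) (d1 t tI)) (d2 t tI)).
  exists (Y ((p + q) / 2) + Y ((p + q) / 2 + a) + Y ((p + q) / 2 - a)) => t tI.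
  by apply: (is_derive_0_oo_cst h) => //; lra.
have [B EB] : exists B, forall t, p < t < q ->
   Y t * cos t + Y (t + a) * cos (t + a) + Y (t - a) * cos (t - a) = B.
  have h t : p < t < q -> is_derive t 1 (fun u => Y u * cos u +
     Y (u + a) * cos (u + a) + Y (u - a) * cos (u - a)) 0.
    move=> tI.
    have dc0 : is_derive t 1 (@cos R) (- sin t) := is_derive_cos t.
    have dc1 := is_derive_shift (is_derive_cos (t + a)).
    have dc2 := is_derive_shift (is_derive_cos (t - a)).
    suff -> : 0 = Y t *: - sin t + cos t *: Y0' t +
       (Y (t + a) *: - sin (t + a) + cos (t + a) *: Y1' t) +
       (Y (t - a) *: - sin (t - a) + cos (t - a) *: Y2' t) :> R.
      exact: (is_deriveD (is_deriveD (is_deriveM (d0 t tI) dc0)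
        (is_deriveM (d1 t tI) dc1)) (is_deriveM (d2 t tI) dc2)).
    rewrite /Y0' /Y1' /Y2' /GRing.scale/= /a cosD2pi3 sinD2pi3 cosB2pi3 sinB2pi3 r3V.
    by field: s33.
  exists (Y ((p + q) / 2) * cos ((p + q) / 2) +
     Y ((p + q) / 2 + a) * cos ((p + q) / 2 + a) +
     Y ((p + q) / 2 - a) * cos ((p + q) / 2 - a)) => t tI.
  by apply: (is_derive_0_oo_cst h) => //; lra.
exists SS, B => t tI.
have s2 := sin2cos2 t; rewrite expr2 in s2.
rewrite /trigonometric -(ES t tI) -(EB t tI) -(sumM t tI) -/a.
rewrite /a cosD2pi3 sinD2pi3 cosB2pi3 sinB2pi3.
by split; field: s33 s2.
Unshelve. all: by end_near. Qed.

(** The signed area is affine in each vertex, which turns maximality of an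
    inscribed triangle into a linear inequality. *)
Definition twice_signed_area (R : realType) (x y z : R * R) : R :=
  (y.1 - x.1) * (z.2 - x.2) - (y.2 - x.2) * (z.1 - x.1).

Lemma triangle_areaE (R : realType) (x y z : R * R) :
  triangle_area x y z = `|twice_signed_area x y z| / 2.
Proof. by []. Qed.

Definition arc_point (R : realType) (f g : R -> R) (c w t : R) : R * R :=
  (c + w * cos t, arc_height f g c w t).

Section Arcs.

Variables (R : realType) (f g : R -> R) (c w : R).

Let Y := arc_height f g c w.

Let P := arc_point f g c w.

Lemma arc_triangle_area t :
  twice_signed_area (P t) (P (t + 2 * pi / 3)) (P (t - 2 * pi / 3)) =
  Num.sqrt 3 * w * (Y t * sin t + Y (t + 2 * pi / 3) * sin (t + 2 * pi / 3) +
                    Y (t - 2 * pi / 3) * sin (t - 2 * pi / 3)).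
Proof.
rewrite /twice_signed_area /P /arc_point/= -/Y.
rewrite cosD2pi3 cosB2pi3 sinD2pi3 sinB2pi3.
by field: (sqrt3_sq R).
Qed.

(** If the triangle at [t] cannot be enlarged by moving its first vertex, no
    point of the curve lies farther from the opposite side. *)
Lemma supported_of_extremal t : 0 < w ->
  (forall s, twice_signed_area (P s) (P (t + 2 * pi / 3)) (P (t - 2 * pi / 3)) <=
             twice_signed_area (P t) (P (t + 2 * pi / 3)) (P (t - 2 * pi / 3))) ->
  supported_at Y t.
Proof.
move=> w0 ext s; have := ext s.
rewrite -subr_ge0 => h; rewrite -subr_ge0.
have k0 : 0 < w * Num.sqrt 3 by rewrite mulr_gt0// sqrt3_gt0.
rewrite -(pmulr_rge0 _ k0); apply: le_trans h _; rewrite le_eqVlt; apply/orP; left.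
apply/eqP; rewrite /twice_signed_area /P /arc_point/= -/Y /opposite_slope.
rewrite cosD2pi3 cosB2pi3.
have r0 : Num.sqrt 3 != 0 :> R by exact: lt0r_neq0 (sqrt3_gt0 R).
by field: (sqrt3_sq R).
Qed.

(** On each of the intervals [(0, pi/3)] and [(pi/3, 2 pi/3)] of [t] all three
    angles avoid the multiples of [pi], so [supported_trigonometric] applies with constants
    [S1, B1] and [S2, B2]. Reducing angles shows that the upper arc uses the
    first pair, then the second, then the first again. The constants agree
    because the two formulas for [f] match at [pi/3] and at [2 pi/3], where the
    cosine takes the values [1/2] and [-1/2]. *)
Lemma extremal_arcs_trigonometric (M : R) : 0 < w ->
  continuous f -> continuous g ->
  (forall s t u, twice_signed_area (P s) (P t) (P u) <= Num.sqrt 3 * w * M) ->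
  (forall t, 0 < t < 2 * pi / 3 ->
    Y t * sin t + Y (t + 2 * pi / 3) * sin (t + 2 * pi / 3) +
    Y (t - 2 * pi / 3) * sin (t - 2 * pi / 3) = M) ->
  exists S B, forall v, 0 <= v <= pi ->
    f (c + w * cos v) = trigonometric S B M v /\
    g (c + w * cos v) = trigonometric S B M (- v).
Proof.
move=> w0 cf cg ext max.
have pi0 := pi_gt0 R.
have perY : periodic Y (2 * pi) := @periodic_arc_height R f g c w.
set a : R := 2 * pi / 3.
have sin_neg (t : R) : - pi < t < 0 -> sin t < 0.
  move=> /andP[t1 t2]; rewrite -[t]opprK sinN oppr_lt0; apply: sin_gt0_pi; lra.
have sin_neg' (t : R) : pi < t < 2 * pi -> sin t < 0.
  move=> /andP[t1 t2]; rewrite -(subrK (pi *+ 2) t) sinD2pi; apply: sin_neg.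
  rewrite mulr2n; lra.
have Ypp t : P (t + a + a) = P (t - a).
  rewrite /P /arc_point (_ : t + a + a = t - a + 2 * pi); last by rewrite /a; field.
  by rewrite -/Y perY mulr_natl cosD2pi.
have Ymm t : P (t - a - a) = P (t + a).
  rewrite -[in RHS](_ : t - a - a + 2 * pi = t + a); last by rewrite /a; field.
  by rewrite /P /arc_point -/Y perY mulr_natl cosD2pi.
have supp t : 0 < t < a ->
  [/\ supported_at Y t, supported_at Y (t + a) & supported_at Y (t - a)].
  move=> ta; have E := arc_triangle_area t; rewrite (max t ta) -/a in E.
  split; apply: supported_of_extremal => // s; rewrite -/a.
  - by rewrite E.
  - rewrite Ypp addrK (_ : twice_signed_area (P (t + a)) _ _ = Num.sqrt 3 * w * M) //.
    by rewrite -E /twice_signed_area; ring.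
  - rewrite Ymm subrK (_ : twice_signed_area (P (t - a)) _ _ = Num.sqrt 3 * w * M) //.
    by rewrite -E /twice_signed_area; ring.
have piece p q : 0 <= p -> p < q -> q <= a ->
    (forall t, p < t < q -> [/\ sin t != 0, sin (t + a) != 0 & sin (t - a) != 0]) ->
    exists S B, forall t, p < t < q ->
    [/\ Y t = trigonometric S B M t, Y (t + a) = trigonometric S B M (t + a) &
        Y (t - a) = trigonometric S B M (t - a)].
  move=> p0 pq qa s0; apply: supported_trigonometric => //.
  - by move=> t; exact: continuous_arc_height.
  - by move=> t tpq; apply: supp; lra.
  - by move=> t tpq; apply: max; rewrite -/a; lra.
(* One of the three angles is a multiple of pi only if t is a multiple of
   pi / 3. *)
have [|||t tI|S1 [B1 I1]] := piece 0 (pi / 3); [by []|lra|rewrite /a; lra| |].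
  split; [apply: lt0r_neq0|apply: lt0r_neq0|apply: ltr0_neq0].
  - by apply: sin_gt0_pi; lra.
  - by apply: sin_gt0_pi; rewrite /a; lra.
  - by apply: sin_neg; rewrite /a; lra.
have [|||t tI|S2 [B2 I2]] := piece (pi / 3) a; [lra|rewrite /a; lra|by []| |].
  move: tI; rewrite /a => tI.
  split; [apply: lt0r_neq0|apply: ltr0_neq0|apply: ltr0_neq0].
  - by apply: sin_gt0_pi; lra.
  - by apply: sin_neg'; lra.
  - by apply: sin_neg; lra.
have Yf t : 0 < t < pi -> Y t = f (c + w * cos t).
  by move=> /sin_gt0_pi/ltW s0; rewrite /Y /arc_height s0.
have Yg t : 0 < t < pi -> Y (- t) = g (c + w * cos t).
  by move=> /sin_gt0_pi s0; rewrite /Y /arc_height sinN cosN oppr_ge0 leNgt s0.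
have YgD t : 0 < t < pi -> Y (2 * pi - t) = g (c + w * cos t).
  by move=> tI; rewrite -Yg// -(perY (- t)) addrC.
have trigD S B t : trigonometric S B M (2 * pi - t) = trigonometric S B M (- t).
  by rewrite mulr_natl [_ - t]addrC /trigonometric sinD2pi cosD2pi.
have fI1 v : 0 < v < pi / 3 -> f (c + w * cos v) = trigonometric S1 B1 M v.
  by move=> vI; rewrite -Yf; [have [] := I1 v vI|lra].
have fI2 v : pi / 3 < v < a -> f (c + w * cos v) = trigonometric S2 B2 M v.
  by rewrite /a => vI; rewrite -Yf; [have [] := I2 v vI|lra].
have fI3 v : a < v < pi -> f (c + w * cos v) = trigonometric S1 B1 M v.
  rewrite /a => vI; rewrite -Yf; last by lra.
  have /I1[_ + _] : 0 < v - a < pi / 3 by rewrite /a; lra.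
  by rewrite subrK.
have gI1 v : 0 < v < pi / 3 -> g (c + w * cos v) = trigonometric S2 B2 M (- v).
  move=> vI; rewrite -Yg; last by lra.
  have /I2[_ _] : pi / 3 < a - v < a by rewrite /a; lra.
  by rewrite addrAC subrr add0r.
have gI2 v : pi / 3 < v < a -> g (c + w * cos v) = trigonometric S1 B1 M (- v).
  rewrite {1}/a => vI; rewrite -Yg; last by lra.
  have /I1[_ _] : 0 < a - v < pi / 3 by rewrite /a; lra.
  by rewrite addrAC subrr add0r.
have gI3 v : a < v < pi -> g (c + w * cos v) = trigonometric S2 B2 M (- v).
  rewrite {1}/a => vI; rewrite -YgD; last by lra.
  have /I2[_ + _] : pi / 3 < 2 * pi - v - a < a by rewrite /a; lra.
  by rewrite subrK trigD.
have ctrig S B : continuous (trigonometric S B M).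
  move=> t; apply: cvgM; last exact: cvg_cst.
  apply: cvgD; [apply: cvgD; first exact: cvg_cst|].
    by apply: cvgM; [exact: cvg_cst|exact: continuous_cos].
  by apply: cvgM; [exact: cvg_cst|exact: continuous_sin].
have ctrigN S B : continuous (fun t => trigonometric S B M (- t)).
  by move=> t; apply: (continuous_comp (@oppr_continuous R R^o t) (ctrig S B _)).
have cfX := @continuous_comp_abscissa R f c w cf.
have cgX := @continuous_comp_abscissa R g c w cg.
have pa : pi / 3 < a by rewrite /a; lra.
have ap : a < pi by rewrite /a; lra.
have p0 : 0 < pi / 3 :> R by lra.
have [f0 f1] := eq_at_ends p0 cfX (ctrig _ _) fI1.
have [f1' f2] := eq_at_ends pa cfX (ctrig _ _) fI2.
have [f2' f3] := eq_at_ends ap cfX (ctrig _ _) fI3.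
have [g0 g1] := eq_at_ends p0 cgX (ctrigN _ _) gI1.
have [g1' g2] := eq_at_ends pa cgX (ctrigN _ _) gI2.
have [g2' g3] := eq_at_ends ap cgX (ctrigN _ _) gI3.
have [ES EB] : S2 = S1 /\ B2 = B1.
  move: f1; rewrite f1' /trigonometric cos_pi3 => E1.
  move: f2'; rewrite f2 /trigonometric cos_2pi3 => E2.
  by split; lra.
move: fI2 gI1 gI3 g0 g1 g2' g3; rewrite ES EB => fI2 gI1 gI3 g0 g1 g2' g3.
exists S1, B1 => v /andP[].
rewrite le_eqVlt => /predU1P[<- _|v0]; first by split.
rewrite le_eqVlt => /predU1P[->|vp]; first by split.
have [v1|v1|->] := ltgtP v (pi / 3); [| |by split].
  by split; [apply: fI1|apply: gI1]; rewrite v0.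
have [v2|v2|->] := ltgtP v a; [| |by split].
  by split; [apply: fI2|apply: gI2]; rewrite v1.
by split; [apply: fI3|apply: gI3]; rewrite v2.
Qed.

End Arcs.

(** * Convex domains as regions between two graphs *)

Definition convex_plane (R : realType) (K : set (R * R)) : Prop :=
  forall p q l, K p -> K q -> 0 <= l <= 1 ->
    K ((1 - l) * p.1 + l * q.1, (1 - l) * p.2 + l * q.2).

Lemma convex_set_plane (R : realType) (K : set (R * R)) :
  convex_set (K : set (convex_lmodType (R^o * R^o)%type)) -> convex_plane K.
Proof.
move=> cK p q l /mem_set Kp /mem_set Kq /andP[l0 l1].
have := cK q p (Itv01 l0 l1) Kq Kp; rewrite inE => Kz.
suff -> : ((1 - l) * p.1 + l * q.1, (1 - l) * p.2 + l * q.2) =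
    l *: (q : (R^o * R^o)%type) + (1 - l) *: (p : (R^o * R^o)%type) by exact: Kz.
by congr pair; rewrite /= addrC.
Qed.

Section UpperGraph.

Variables (R : realType) (K : set (R * R)) (a b : R).

Hypotheses (compactK : compact K) (convexK : convex_plane K) (ab : a < b).

Hypotheses (Ka : exists y, K (a, y)) (Kb : exists y, K (b, y)).

Lemma continuous_fst_plane (A : set (R * R)) : {within A, continuous fst}.
Proof. by apply: continuous_subspaceT => p; exact: cvg_fst. Qed.

Lemma continuous_snd_plane (A : set (R * R)) : {within A, continuous snd}.
Proof. by apply: continuous_subspaceT => p; exact: cvg_snd. Qed.

Lemma section_nonempty x : a <= x <= b -> exists y, K (x, y).
Proof.
move=> /andP[ax xb]; have [ya Kya] := Ka; have [yb Kyb] := Kb.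
pose l := (x - a) / (b - a).
have ba : 0 < b - a by rewrite subr_gt0.
have l01 : 0 <= l <= 1.
  by rewrite /l divr_ge0 ?subr_ge0 ?(ltW ab)//= ler_pdivrMr// mul1r lerD2r.
exists ((1 - l) * ya + l * yb); have := convexK Kya Kyb l01.
congr (K _); congr pair; rewrite /l /=; field; exact: lt0r_neq0.
Qed.

Lemma section_max x : a <= x <= b ->
  exists y, K (x, y) /\ forall y', K (x, y') -> y' <= y.
Proof.
move=> /section_nonempty[y Ky].
have closedL : closed [set p : R * R | p.1 = x].
  have -> : [set p : R * R | p.1 = x] = fst @^-1` [set x] by [].
  apply: preimage_closed; last exact: closed_eq.
  by move=> p _; exact: cvg_fst.
have cL : compact (K `&` [set p | p.1 = x]).
  exact: compact_closedI.
have neL : K `&` [set p | p.1 = x] !=set0 by exists (x, y).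
have [[x' z] /set_mem[/= Kz x'x] zmax] := compact_EVT_max neL cL (@continuous_snd_plane _).
rewrite x'x in Kz; exists z; split => // y' Ky'.
by have /= := zmax (x, y'); apply; apply/mem_set.
Qed.

(** Upper semicontinuity holds because the part of [K] above a given height is
    compact and so projects onto a closed set. Lower semicontinuity, including
    at the ends [a] and [b], holds because [f] lies above its chords to [a] and to
    [b]. Outside [a, b] the function is extended by constants, so that it is
    continuous on the whole line. *)
Lemma continuous_upper_graph : exists f : R -> R, continuous f /\
  forall x, a <= x <= b -> K (x, f x) /\ forall y, K (x, y) -> y <= f x.
Proof.
have [f0 Hf0] : exists f0 : R -> R, forall x, a <= x <= b ->
    K (x, f0 x) /\ forall y, K (x, y) -> y <= f0 x.
  have /choice[f0 Hf0] : forall x, exists y, a <= x <= b ->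
      K (x, y) /\ forall y', K (x, y') -> y' <= y.
    move=> x; have [/section_max[y Hy]|nx] := boolP (a <= x <= b).
      by exists y.
    by exists 0.
  by exists f0.
pose clamp x := Num.max a (Num.min b x).
have clampI x : a <= clamp x <= b.
  by rewrite /clamp le_max lexx/= ge_max ltW//= ge_min lexx.
have clampE x : a <= x <= b -> clamp x = x.
  by move=> /andP[ax xb]; rewrite /clamp (min_idPr xb) (max_idPr ax).
have clampc : continuous clamp.
  move=> x; apply: continuous_max; first exact: cvg_cst.
  by apply: continuous_min; [exact: cvg_cst|exact: cvg_id].
have usc x e : a <= x <= b -> 0 < e ->
    \forall u \near x, a <= u <= b -> f0 u < f0 x + e.
  move=> xI e0.
  pose C := K `&` [set p | f0 x + e <= p.2].
  have closedC : closed [set p : R * R | f0 x + e <= p.2].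
    have -> : [set p : R * R | f0 x + e <= p.2] = snd @^-1` [set y | f0 x + e <= y] by [].
    apply: preimage_closed; last exact: closed_ge.
    by move=> p _; exact: cvg_snd.
  have cC : compact C by exact: compact_closedI.
  have clC : closed (fst @` C).
    apply: compact_closed; first exact: Rhausdorff.
    by apply: continuous_compact => //; exact: continuous_fst_plane.
  have nx : ~ (fst @` C) x.
    move=> [[x' y] [/= Ky ey] /= x'x]; rewrite x'x in Ky.
    have [_ /(_ y Ky)] := Hf0 x xI; rewrite leNgt => /negP; apply.
    by apply: lt_le_trans ey; rewrite ltrDl.
  have op : nbhs x (~` (fst @` C)).
    by apply: open_nbhs_nbhs; split => //; exact: closed_openC.
  apply: filterS op => u nu uI; rewrite ltNge; apply/negP => le; apply: nu.
  by exists (u, f0 u) => //; split => //=; have [] := Hf0 u uI.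
have lsc x e : a <= x <= b -> 0 < e ->
    \forall u \near x, a <= u <= b -> f0 x - e < f0 u.
  move=> xI e0; have [ax xb] := andP xI.
  pose chord d u := f0 x + (u - x) / (d - x) * (f0 d - f0 x).
  have cchord d : chord d u @[u --> x] --> f0 x.
    have : chord d u @[u --> x] --> f0 x + (x - x) / (d - x) * (f0 d - f0 x).
      apply: cvgD; first exact: cvg_cst.
      apply: cvgM; last exact: cvg_cst.
      apply: cvgM; last exact: cvg_cst.
      by apply: cvgB; [exact: cvg_id|exact: cvg_cst].
    by rewrite subrr !mul0r addr0.
  have chord_le d u : a <= d <= b -> a <= u <= b -> d != x ->
      0 <= (u - x) / (d - x) <= 1 -> chord d u <= f0 u.
    move=> dI uI dx lI; have [Kx _] := Hf0 x xI; have [Kd _] := Hf0 d dI.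
    have [_] := Hf0 u uI; apply; have := convexK Kx Kd lI.
    have dx0 : d - x != 0 by rewrite subr_eq0.
    by congr (K _); congr pair; rewrite /chord /=; field.
  have ex : f0 x - e < f0 x by rewrite gtrBl.
  have nb : \forall u \near x, f0 x - e < chord b u.
    by move/cvgr_gt : (cchord b); apply.
  have na : \forall u \near x, f0 x - e < chord a u.
    by move/cvgr_gt : (cchord a); apply.
  near=> u => uI; have [au ub] := andP uI.
  have [ux|xu|->] := ltgtP u x; last by [].
  - have ax' : a < x := le_lt_trans au ux.
    apply: (@lt_le_trans _ _ (chord a u)); first exact: (near na u).
    apply: chord_le => //; [by rewrite lexx ltW|by rewrite lt_eqF|].
    have xa0 : 0 < x - a by rewrite subr_gt0.
    have -> : (u - x) / (a - x) = (x - u) / (x - a).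
      by rewrite -[LHS]mulrNN -invrN !opprB.
    by rewrite divr_ge0 ?subr_ge0 ?(ltW ux) ?(ltW ax')//= ler_pdivrMr// mul1r lerD2l lerN2.
  - have xb' : x < b := lt_le_trans xu ub.
    apply: (@lt_le_trans _ _ (chord b u)); first exact: (near nb u).
    apply: chord_le => //; [by rewrite lexx ltW|by rewrite gt_eqF|].
    have bx0 : 0 < b - x by rewrite subr_gt0.
    by rewrite divr_ge0 ?subr_ge0 ?(ltW xu) ?(ltW xb')//= ler_pdivrMr// mul1r lerD2r.
exists (f0 \o clamp); split; last first.
  by move=> x xI /=; rewrite clampE//; exact: Hf0.
move=> x; apply/cvgrPdist_lt => e e0.
have n1 := usc (clamp x) e (clampI x) e0.
have n2 := lsc (clamp x) e (clampI x) e0.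
have n1' : \forall u \near x, a <= clamp u <= b -> f0 (clamp u) < f0 (clamp x) + e.
  exact: (clampc x _ n1).
have n2' : \forall u \near x, a <= clamp u <= b -> f0 (clamp x) - e < f0 (clamp u).
  exact: (clampc x _ n2).
near=> u; rewrite /= distrC ltr_distl; apply/andP; split.
  by near: u; apply: filterS n2' => u; apply; exact: clampI.
by near: u; apply: filterS n1' => u; apply; exact: clampI.
Unshelve. all: by end_near. Qed.

End UpperGraph.

(** The lower function is minus the upper function of the image of [K] under
    the reflection [(x, y) -> (x, - y)]. *)
Lemma convex_domain_graphs (R : realType) (K : set (R * R)) :
  convex_domain K -> exists c w (f g : R -> R),
    [/\ 0 < w, continuous f, continuous g,
        forall x, c - w <= x <= c + w -> g x <= f x &
        forall p, K p <-> c - w <= p.1 <= c + w /\ g p.1 <= p.2 <= f p.1].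
Proof.
move=> [/convex_set_plane vK cK [p0 intp0]].
have K0 : K !=set0 by exists p0; exact: interior_subset.
have [pb /set_mem Kpb maxb] := compact_EVT_max K0 cK (@continuous_fst_plane _ _).
have [pa /set_mem Kpa mina] := compact_EVT_min K0 cK (@continuous_fst_plane _ _).
set a := pa.1 in mina; set b := pb.1 in maxb.
have KI p : K p -> a <= p.1 <= b.
  by move=> /mem_set Kp; rewrite mina//= maxb.
have Ka : exists y, K (a, y) by exists pa.2; rewrite -surjective_pairing.
have Kb : exists y, K (b, y) by exists pb.2; rewrite -surjective_pairing.
have ab : a < b.
  have line : (u, p0.2) @[u --> p0.1] --> p0.
    rewrite [p0 in X in _ --> X]surjective_pairing.
    apply: (@cvg_pair _ _ _ _ (nbhs p0.1) (nbhs p0.2)); [exact: cvg_id|exact: cvg_cst].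
  have nK : \forall u \near p0.1^'+, K (u, p0.2).
    apply: cvg_within; exact: (line _ intp0).
  suff : \forall u \near p0.1^'+, a < b by move=> /filter_ex[].
  near=> u.
  have /andP[a0 _] := KI _ (interior_subset intp0).
  have /KI/andP[_ /= ub] : K (u, p0.2) by near: u.
  apply: le_lt_trans a0 (lt_le_trans _ ub); near: u; exact: nbhs_right_gt.
have [f [cf Hf]] := continuous_upper_graph cK vK ab Ka Kb.
pose K' : set (R * R) := [set p | K (p.1, - p.2)].
have cK' : compact K'.
  have -> : K' = (fun p : R * R => (p.1, - p.2)) @` K.
    apply/seteqP; split => [[x y] /= Kxy|_ [[x y] /= Kxy <-]].
      by exists (x, - y) => //=; rewrite opprK.
    by rewrite /K' /= opprK.
  apply: continuous_compact => //; apply: continuous_subspaceT => p.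
  apply: (@cvg_pair _ _ _ _ (nbhs p.1) (nbhs (- p.2))).
    exact: cvg_fst.
  by apply: cvgN; exact: cvg_snd.
have vK' : convex_plane K'.
  move=> p q l Kp Kq l01; have := vK _ _ _ Kp Kq l01.
  by congr (K _); congr pair; rewrite /=; ring.
have Ka' : exists y, K' (a, y).
  by have [y Ky] := Ka; exists (- y); rewrite /K' /= opprK.
have Kb' : exists y, K' (b, y).
  by have [y Ky] := Kb; exists (- y); rewrite /K' /= opprK.
have [g [cg Hg]] := continuous_upper_graph cK' vK' ab Ka' Kb'.
have ca : (a + b) / 2 - (b - a) / 2 = a by field.
have cb : (a + b) / 2 + (b - a) / 2 = b by field.
exists ((a + b) / 2), ((b - a) / 2), f, (fun x => - g x); rewrite ca cb; split=> //.
- by rewrite divr_gt0// subr_gt0.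
- by move=> x; apply: cvgN; exact: cg.
- move=> x xI; have [_] := Hf x xI; apply.
  by have [] := Hg x xI.
- move=> [x y]; split=> /= [Kxy|[xI /andP[gy yf]]].
    have xI := KI _ Kxy; split => //; have [_ fm] := Hf x xI; have [_ gm] := Hg x xI.
    rewrite fm// andbT lerNl; apply: gm.
    by rewrite /K' /= opprK.
  have [Kf _] := Hf x xI; have [Kg _] := Hg x xI.
  have [E|gf] := eqVneq (f x) (- g x).
    by have -> : y = f x by apply/le_anti; rewrite yf E gy.
  have fg0 : 0 < f x + g x.
    by rewrite lt_neqAle eq_sym addr_eq0 gf/= -[g x]opprK subr_ge0 (le_trans gy).
  have l01 : 0 <= (y + g x) / (f x + g x) <= 1.
    rewrite divr_ge0 ?(ltW fg0)//=; last by rewrite -lerBlDr sub0r.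
    by rewrite ler_pdivrMr// mul1r lerD2r.
  have := vK _ _ _ Kg Kf l01.
  by congr (K _); congr pair; rewrite /=; field; rewrite lt0r_neq0.
Unshelve. all: by end_near. Qed.

Lemma boundary_vertical (R : realType) (K : set (R * R)) (x y : R) :
  K (x, y) ->
  (forall y', K (x, y') -> y' <= y) \/ (forall y', K (x, y') -> y <= y') ->
  boundary K (x, y).
Proof.
move=> Kxy ext; split; first exact: subset_closure.
move=> intK.
have line : (x, u) @[u --> y] --> (x, y).
  by apply: (@cvg_pair _ _ _ _ (nbhs x) (nbhs y)); [exact: cvg_cst|exact: cvg_id].
case: ext => [ymax|ymin].
  have nK : \forall u \near y^'+, K (x, u) by apply: cvg_within; exact: (line _ intK).
  suff : \forall u \near y^'+, False by move=> /filter_ex[].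
  near=> u; have : u <= y by apply: ymax; near: u.
  by rewrite leNgt => /negP; apply; near: u; exact: nbhs_right_gt.
have nK : \forall u \near y^'-, K (x, u) by apply: cvg_within; exact: (line _ intK).
suff : \forall u \near y^'-, False by move=> /filter_ex[].
near=> u; have : y <= u by apply: ymin; near: u.
by rewrite leNgt => /negP; apply; near: u; exact: nbhs_left_lt.
Unshelve. all: by end_near. Qed.

Lemma boundary_arc_point (R : realType) (K : set (R * R)) (f g : R -> R) (c w t : R) :
  0 < w -> (forall x, c - w <= x <= c + w -> g x <= f x) ->
  (forall p, K p <-> c - w <= p.1 <= c + w /\ g p.1 <= p.2 <= f p.1) ->
  boundary K (arc_point f g c w t).
Proof.
move=> w_gt0 legf KE.
have xI : c - w <= c + w * cos t <= c + w.
  have h1 : 0 <= w * (1 - cos t) by rewrite mulr_ge0 ?(ltW w_gt0)// subr_ge0 cos_le1.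
  have h2 : 0 <= w * (cos t - -1) by rewrite mulr_ge0 ?(ltW w_gt0)// subr_ge0 cos_geN1.
  lra.
have gf := legf _ xI.
rewrite /arc_point /arc_height; case: ifP => _.
- apply: boundary_vertical; last by left=> y /KE[_ /andP[]].
  by apply/KE; rewrite /= gf lexx.
- apply: boundary_vertical; last by right=> y /KE[_ /andP[]].
  by apply/KE; rewrite /= gf lexx.
Qed.

(** * Ellipses in sheared coordinates *)

(** The image of the unit disc under the map
    [(u, v) -> (c + w u, d + m u + k v)]. Every ellipse has this form, in which
    the vertical sections are explicit. *)
Definition sheared_ellipse (R : realType) (c d w k m : R) : set (R * R) :=
  [set p | ((p.1 - c) / w) ^+ 2 + ((p.2 - d - m * ((p.1 - c) / w)) / k) ^+ 2 <= 1].

(** The matrix of the form on the left is the inverse of [R diag(a^2, b^2) R^T],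
    with [R] the rotation of cosine [C] and sine [S]; that of the form on the
    right is the inverse of [L L^T], with [L] lower triangular of rows [(w, 0)]
    and [(m, k)]. The hypotheses equate the first rows and the determinants of
    these two symmetric matrices, hence the matrices. *)
Lemma quadratic_form_sheared (R : realType) (C S a b w k m X Y : R) :
  0 < a -> 0 < b -> 0 < w -> 0 < k -> C ^+ 2 + S ^+ 2 = 1 ->
  w ^+ 2 = a ^+ 2 * C ^+ 2 + b ^+ 2 * S ^+ 2 ->
  w * m = (a ^+ 2 - b ^+ 2) * C * S -> w * k = a * b ->
  ((X * C + Y * S) / a) ^+ 2 + ((Y * C - X * S) / b) ^+ 2 =
  (X / w) ^+ 2 + ((Y - m * (X / w)) / k) ^+ 2.
Proof.
move=> a0 b0 w0 k0 CS Ew Em Ek.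
have [an bn wn kn] : [/\ a != 0, b != 0, w != 0 & k != 0].
  by split; exact: lt0r_neq0.
have Er : k ^+ 2 + m ^+ 2 = b ^+ 2 * C ^+ 2 + a ^+ 2 * S ^+ 2.
  apply: (mulfI (expf_neq0 2 wn)).
  have -> : w ^+ 2 * (k ^+ 2 + m ^+ 2) = (w * k) ^+ 2 + (w * m) ^+ 2 by ring.
  rewrite Em Ek Ew.
  have -> : (a * b) ^+ 2 = (a * b * (C ^+ 2 + S ^+ 2)) ^+ 2 by rewrite CS mulr1.
  by ring.
have abn : a ^+ 2 * b ^+ 2 != 0 by rewrite mulf_neq0// expf_neq0.
apply: (mulfI abn).
have -> : a ^+ 2 * b ^+ 2 * (((X * C + Y * S) / a) ^+ 2 + ((Y * C - X * S) / b) ^+ 2) =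
  X ^+ 2 * (b ^+ 2 * C ^+ 2 + a ^+ 2 * S ^+ 2) +
  Y ^+ 2 * (a ^+ 2 * C ^+ 2 + b ^+ 2 * S ^+ 2) -
  2 * X * Y * ((a ^+ 2 - b ^+ 2) * C * S) by field; rewrite an bn.
have -> : a ^+ 2 * b ^+ 2 = w ^+ 2 * k ^+ 2 by rewrite -!exprMn Ek.
rewrite -Er -Ew -Em.
by field; rewrite wn kn.
Qed.

Lemma polar_angle (R : realType) (x y : R) : exists t,
  x = Num.sqrt (x ^+ 2 + y ^+ 2) * cos t /\ y = Num.sqrt (x ^+ 2 + y ^+ 2) * sin t.
Proof.
set r := Num.sqrt _.
have xy0 : 0 <= x ^+ 2 + y ^+ 2 by rewrite addr_ge0 ?sqr_ge0.
have rr : r ^+ 2 = x ^+ 2 + y ^+ 2 by rewrite sqr_sqrtr.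
have [r0|rn] := eqVneq r 0.
  have := rr; rewrite r0 expr0n/= => /esym/eqP; rewrite paddr_eq0 ?sqr_ge0//.
  by rewrite !sqrf_eq0 => /andP[/eqP -> /eqP ->]; exists 0; rewrite !mul0r.
have r0 : 0 < r by rewrite lt_neqAle eq_sym rn sqrtr_ge0.
have xr : -1 <= x / r <= 1.
  rewrite -ler_norml normrM normfV (gtr0_norm r0) ler_pdivrMr// mul1r.
  by rewrite /r -sqrtr_sqr ler_wsqrtr// lerDl sqr_ge0.
have cosE : cos (acos (x / r)) = x / r by rewrite acosK// in_itv.
have sinE : sin (acos (x / r)) = `|y| / r.
  rewrite sin_acos//.
  have -> : 1 - (x / r) ^+ 2 = (y / r) ^+ 2.
    rewrite !expr_div_n; apply: (mulIf (expf_neq0 2 rn)).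
    by rewrite mulrBl mul1r !divfK ?expf_neq0// rr addrC addKr.
  by rewrite sqrtr_sqr normrM normfV (gtr0_norm r0).
have [y0|y0] := lerP 0 y.
  (* The arc cosine covers the upper half plane; its opposite the lower one. *)
  exists (acos (x / r)); rewrite cosE sinE ger0_norm//.
  by split; rewrite mulrC divfK.
exists (- acos (x / r)); rewrite cosN sinN cosE sinE ltr0_norm// mulNr opprK.
by split; rewrite mulrC divfK.
Qed.

(** Diagonalization of the symmetric matrix with diagonal entries [w^2] and
    [m^2 + k^2] and off-diagonal entry [w m]. The number [D] of the
    proof is the difference of its eigenvalues [a^2] and [b^2], and [2 t] is the polar angle
    of the vector formed by the difference of its diagonal entries and twice
    its off-diagonal entry. *)
Lemma principal_axes (R : realType) (w k m : R) : 0 < w -> 0 < k ->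
  exists t a b, [/\ 0 < a, 0 < b,
    w ^+ 2 = a ^+ 2 * cos t ^+ 2 + b ^+ 2 * sin t ^+ 2,
    w * m = (a ^+ 2 - b ^+ 2) * cos t * sin t & w * k = a * b].
Proof.
move=> w0 k0.
pose p := w ^+ 2; pose q := w * m; pose r := m ^+ 2 + k ^+ 2.
have [t [Ec Es]] := polar_angle (p - r) (2 * q).
set D := Num.sqrt _ in Ec Es.
have D0 : 0 <= D by exact: sqrtr_ge0.
have DD : D ^+ 2 = (p - r) ^+ 2 + (2 * q) ^+ 2.
  by rewrite sqr_sqrtr// addr_ge0 ?sqr_ge0.
have wk0 : 0 < w * k by rewrite mulr_gt0.
have p0 : 0 < p by rewrite exprn_gt0.
have r0 : 0 < r by rewrite ltr_wpDl ?sqr_ge0// exprn_gt0.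
have det : (p + r) ^+ 2 - D ^+ 2 = 4 * (w * k) ^+ 2 by rewrite DD /p /q /r; ring.
have Dlt : D < p + r.
  have pr0 : 0 <= p + r by rewrite addr_ge0// ltW.
  rewrite -(@ltr_pXn2r _ 2)// ?nnegrE//.
  by rewrite -subr_gt0 det mulr_gt0 ?exprn_gt0.
have l1 : 0 < (p + r + D) / 2 by rewrite divr_gt0// ltr_pwDl// addr_gt0.
have l2 : 0 < (p + r - D) / 2 by rewrite divr_gt0// subr_gt0.
have [u tu] : exists u, t = u *+ 2 by exists (t / 2); rewrite mulr2n; field.
move: Ec Es; rewrite tu cos_mulr2n sin_mulr2n => Ec Es.
exists u, (Num.sqrt ((p + r + D) / 2)), (Num.sqrt ((p + r - D) / 2)).
rewrite !sqrtr_gt0 !sqr_sqrtr ?(ltW l1) ?(ltW l2)//; split=> //.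
- have Ec' : D * cos u ^+ 2 = (p - r + D) / 2 by rewrite Ec mulr2n; field.
  rewrite sin2cos2 -/p.
  transitivity ((p + r - D) / 2 + D * cos u ^+ 2); last by field.
  by rewrite Ec'; field.
- have Es' : D * cos u * sin u = q.
    have -> : q = 2 * q / 2 by field.
    by rewrite Es mulr2n; field.
  by rewrite -/q -Es'; field.
- rewrite -sqrtrM ?(ltW l1)//.
  have -> : (p + r + D) / 2 * ((p + r - D) / 2) = (w * k) ^+ 2.
    have -> : (w * k) ^+ 2 = ((p + r) ^+ 2 - D ^+ 2) / 4 by rewrite det; field.
    by field.
  by rewrite sqrtr_sqr gtr0_norm.
Qed.

Lemma ellipseP (R : realType) (K : set (R * R)) :
  ellipse K <-> exists c d w k m,
    [/\ 0 < w, 0 < k & K = sheared_ellipse c d w k m].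
Proof.
have E (c p : R * R) (t a b w k m : R) : 0 < a -> 0 < b -> 0 < w -> 0 < k ->
    w ^+ 2 = a ^+ 2 * cos t ^+ 2 + b ^+ 2 * sin t ^+ 2 ->
    w * m = (a ^+ 2 - b ^+ 2) * cos t * sin t -> w * k = a * b ->
    (dot (p - c) (unit_dir t) / a) ^+ 2 +
    (dot (p - c) (unit_dir (t + pi / 2)) / b) ^+ 2 =
    ((p.1 - c.1) / w) ^+ 2 + ((p.2 - c.2 - m * ((p.1 - c.1) / w)) / k) ^+ 2.
  move=> a0 b0 w0 k0 Ew Em Ek.
  rewrite -(quadratic_form_sheared _ _ a0 b0 w0 k0 (cos2Dsin2 t) Ew Em Ek).
  rewrite /dot /unit_dir /= cosDpihalf sinDpihalf.
  by congr (_ + (_ / _) ^+ 2); ring.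
split=> [[c [t [a [b [a0 b0 ->]]]]]|[c [d [w [k [m [w0 k0 ->]]]]]]].
  pose w := Num.sqrt (a ^+ 2 * cos t ^+ 2 + b ^+ 2 * sin t ^+ 2).
  have pos : 0 < a ^+ 2 * cos t ^+ 2 + b ^+ 2 * sin t ^+ 2.
    have a2 : 0 < a ^+ 2 by rewrite exprn_gt0.
    have b2 : 0 < b ^+ 2 by rewrite exprn_gt0.
    have := cos2Dsin2 t; have := sqr_ge0 (cos t); have := sqr_ge0 (sin t).
    move: (cos t ^+ 2) (sin t ^+ 2) (a ^+ 2) (b ^+ 2) a2 b2 => C S A B A0 B0 S0 C0 CS.
    have [C1|C1] := eqVneq C 0; first by rewrite C1 mulr0 add0r mulr_gt0//; lra.
    by rewrite ltr_wpDr ?mulr_ge0 ?(ltW B0)// mulr_gt0// lt_neqAle eq_sym C1.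
  have w0 : 0 < w by rewrite sqrtr_gt0.
  have ab0 : 0 < a * b / w by rewrite divr_gt0// mulr_gt0.
  have wn : w != 0 := lt0r_neq0 w0.
  pose k := a * b / w; pose m := (a ^+ 2 - b ^+ 2) * cos t * sin t / w.
  have Ew : w ^+ 2 = a ^+ 2 * cos t ^+ 2 + b ^+ 2 * sin t ^+ 2.
    by rewrite sqr_sqrtr// ltW.
  have Em : w * m = (a ^+ 2 - b ^+ 2) * cos t * sin t by rewrite mulrC divfK.
  have Ek : w * k = a * b by rewrite mulrC divfK.
  exists c.1, c.2, w, k, m; split=> //.
  by apply/seteqP; split => p;
    rewrite /sheared_ellipse /= (E c p t a b w k m a0 b0 w0 ab0 Ew Em Ek).
have [t [a [b [a0 b0 Ew Em Ek]]]] := principal_axes m w0 k0.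
exists (c, d), t, a, b; split=> //.
by apply/seteqP; split => p;
  rewrite /sheared_ellipse /= (E (c, d) p t a b w k m a0 b0 w0 k0 Ew Em Ek).
Qed.

Lemma normalized_abscissa (R : realType) (c w x : R) : 0 < w ->
  (c - w <= x <= c + w) = (-1 <= (x - c) / w <= 1).
Proof.
move=> w0; rewrite -ler_distl -ler_norml normrM normfV (gtr0_norm w0).
by rewrite ler_pdivrMr// mul1r.
Qed.

Lemma sheared_ellipse_section (R : realType) (c d w k m x y : R) :
  0 < w -> 0 < k -> sheared_ellipse c d w k m (x, y) <->
  c - w <= x <= c + w /\
  d + m * ((x - c) / w) - k * Num.sqrt (1 - ((x - c) / w) ^+ 2) <= y <=
  d + m * ((x - c) / w) + k * Num.sqrt (1 - ((x - c) / w) ^+ 2).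
Proof.
move=> w0 k0; rewrite /sheared_ellipse /= normalized_abscissa//.
set X := (x - c) / w; rewrite -ler_distl -addrA -opprD; set Z := y - _.
have -> : (`|Z| <= k * Num.sqrt (1 - X ^+ 2)) = (`|Z / k| <= Num.sqrt (1 - X ^+ 2)).
  by rewrite normrM normfV (gtr0_norm k0) ler_pdivrMr// mulrC.
have -> : (-1 <= X <= 1) = (X ^+ 2 <= 1).
  by rewrite -ler_norml -sqrtr_sqr -[X in _ <= X]sqrtr1 ler_sqrt.
split=> [h|[X1 h]].
  have X1 : X ^+ 2 <= 1 by apply: le_trans h; rewrite lerDl sqr_ge0.
  by split=> //; rewrite -sqrtr_sqr ler_wsqrtr// lerBrDl.
by move: h; rewrite -sqrtr_sqr ler_sqrt ?subr_ge0// lerBrDl.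
Qed.

(** The arcs at the angle [v] with cosine [(x - c) / w] are the ends of the
    vertical sections of the sheared ellipse. *)
Lemma trigonometric_arcs_ellipse (R : realType) (K : set (R * R)) (f g : R -> R)
    (c w S B M : R) :
  0 < w -> 0 < M ->
  (forall p, K p <-> c - w <= p.1 <= c + w /\ g p.1 <= p.2 <= f p.1) ->
  (forall v, 0 <= v <= pi -> f (c + w * cos v) = trigonometric S B M v /\
                             g (c + w * cos v) = trigonometric S B M (- v)) ->
  K = sheared_ellipse c (S / 3) w (2 * M / 3) (2 * B / 3).
Proof.
move=> w0 M0 KE trig; have wn := lt0r_neq0 w0.
have k0 : 0 < 2 * M / 3 by rewrite divr_gt0// mulr_gt0.
have graphs x : c - w <= x <= c + w ->
    f x = S / 3 + 2 * B / 3 * ((x - c) / w) +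
          2 * M / 3 * Num.sqrt (1 - ((x - c) / w) ^+ 2) /\
    g x = S / 3 + 2 * B / 3 * ((x - c) / w) -
          2 * M / 3 * Num.sqrt (1 - ((x - c) / w) ^+ 2).
  rewrite normalized_abscissa// => xI.
  have [] := trig (acos ((x - c) / w)); first by rewrite acos_ge0// acos_lepi.
  rewrite /trigonometric sinN cosN sin_acos// acosK ?in_itv//.
  rewrite mulrC divfK// addrC subrK => -> ->.
  by split; field.
apply/seteqP; split=> -[x y].
  move=> /KE[/= xI yI]; apply/sheared_ellipse_section => //.
  by have [<- <-] := graphs x xI.
move=> /(sheared_ellipse_section _ _ _ _ _ w0 k0)[xI]; have [<- <-] := graphs x xI.
by move=> yI; apply/KE.
Qed.

Lemma sheared_ellipse_graphs (R : realType) (c d w k m : R) : 0 < w -> 0 < k ->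
  exists f g : R -> R,
  [/\ continuous f, continuous g, forall x, c - w <= x <= c + w -> g x <= f x,
      forall p, sheared_ellipse c d w k m p <->
                c - w <= p.1 <= c + w /\ g p.1 <= p.2 <= f p.1 &
      forall t, arc_height f g c w t = d + m * cos t + k * sin t].
Proof.
move=> w0 k0; have wn := lt0r_neq0 w0; have kn := lt0r_neq0 k0.
pose X x := (x - c) / w.
pose r x := k * Num.sqrt (1 - X x ^+ 2).
pose mid x := d + m * X x.
have cX : continuous X.
  by move=> x; apply: cvgM; [apply: cvgB; [exact: cvg_id|exact: cvg_cst]|exact: cvg_cst].
have cmid : continuous mid.
  move=> x; apply: cvgD; first exact: cvg_cst.
  by apply: cvgM; [exact: cvg_cst|exact: cX].
have cr : continuous r.
  move=> x; apply: cvgM; first exact: cvg_cst.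
  have cq : 1 - X u ^+ 2 @[u --> x] --> 1 - X x ^+ 2.
    apply: cvgB; first exact: cvg_cst.
    by rewrite expr2; under eq_fun do rewrite expr2; apply: cvgM; exact: cX.
  exact: (continuous_comp cq (@sqrt_continuous R _)).
have r0 x : 0 <= r x by rewrite mulr_ge0 ?sqrtr_ge0// ltW.
exists (fun x => mid x + r x), (fun x => mid x - r x); split.
- by move=> x; apply: cvgD; [exact: cmid|exact: cr].
- by move=> x; apply: cvgB; [exact: cmid|exact: cr].
- by move=> x _; rewrite lerD2l (le_trans _ (r0 x))// oppr_le0.
- by move=> [x y]; exact: sheared_ellipse_section.
- move=> t; have Xt : X (c + w * cos t) = cos t by rewrite /X; field.
  rewrite /arc_height /mid /r Xt -sin2cos2 sqrtr_sqr; case: ifPn => [s0|].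
    by rewrite ger0_norm.
  by rewrite -ltNge => s0; rewrite ltr0_norm// mulrN opprK.
Qed.

(** The sum [S] of the squared sides is at least [4 sqrt 3] times the area
    (Weitzenboeck; the defect is a sum of two squares, which vanishes for
    equilateral triangles), and at most [9] since it is three times the sum of
    the squared norms of the vertices minus the squared norm of their sum. *)
Lemma triangle_in_unit_disc (R : realType) (x1 y1 x2 y2 x3 y3 : R) :
  x1 ^+ 2 + y1 ^+ 2 <= 1 -> x2 ^+ 2 + y2 ^+ 2 <= 1 -> x3 ^+ 2 + y3 ^+ 2 <= 1 ->
  (x2 - x1) * (y3 - y1) - (y2 - y1) * (x3 - x1) <= 3 * Num.sqrt 3 / 2.
Proof.
move=> h1 h2 h3; have r0 := sqrt3_gt0 R; have rr := sqrt3_sq R.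
set D := _ - _.
suff : 2 * Num.sqrt 3 * D <= 9.
  rewrite -[9](_ : 2 * Num.sqrt 3 * (3 * Num.sqrt 3 / 2) = 9); last by field: rr.
  by rewrite ler_pM2l// mulr_gt0.
pose S := (x2 - x1) ^+ 2 + (y2 - y1) ^+ 2 + (x3 - x1) ^+ 2 + (y3 - y1) ^+ 2 +
          (x3 - x2) ^+ 2 + (y3 - y2) ^+ 2.
apply: (@le_trans _ _ S).
  rewrite -subr_ge0.
  (* One side vector minus the other one turned by a sixth of a full turn. *)
  pose e1 := x2 - x1 - (x3 - x1) / 2 - Num.sqrt 3 / 2 * (y3 - y1).
  pose e2 := y2 - y1 - (y3 - y1) / 2 + Num.sqrt 3 / 2 * (x3 - x1).
  have -> : S - 2 * Num.sqrt 3 * D = 2 * (e1 ^+ 2 + e2 ^+ 2).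
    by rewrite /S /D /e1 /e2; field: rr.
  by rewrite mulr_ge0// addr_ge0 ?sqr_ge0.
have -> : S = 3 * ((x1 ^+ 2 + y1 ^+ 2) + (x2 ^+ 2 + y2 ^+ 2) + (x3 ^+ 2 + y3 ^+ 2)) -
   ((x1 + x2 + x3) ^+ 2 + (y1 + y2 + y3) ^+ 2) by rewrite /S; ring.
have := sqr_ge0 (x1 + x2 + x3); have := sqr_ge0 (y1 + y2 + y3); lra.
Qed.

Lemma triangle_in_sheared_ellipse (R : realType) (c d w k m : R) (x y z : R * R) :
  0 < w -> 0 < k -> sheared_ellipse c d w k m x ->
  sheared_ellipse c d w k m y -> sheared_ellipse c d w k m z ->
  triangle_area x y z <= 3 * Num.sqrt 3 / 4 * w * k.
Proof.
move=> w0 k0; have wn := lt0r_neq0 w0; have kn := lt0r_neq0 k0.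
wlog pos : y z / 0 <= twice_signed_area x y z.
  move=> W Kx Ky Kz; have [h|h] := lerP 0 (twice_signed_area x y z); first exact: W.
  have E : twice_signed_area x z y = - twice_signed_area x y z.
    by rewrite /twice_signed_area; ring.
  by rewrite triangle_areaE -normrN -E -triangle_areaE; apply: W; rewrite // E oppr_ge0 ltW.
rewrite /sheared_ellipse /= => Kx Ky Kz.
have := triangle_in_unit_disc Kx Ky Kz; set D := (X in X <= _) => DM.
have E : twice_signed_area x y z = w * k * D.
  by rewrite /twice_signed_area /D; field; rewrite wn kn.
rewrite triangle_areaE ger0_norm// E.
have wk0 : 0 < w * k by rewrite mulr_gt0.
rewrite ler_pdivrMr// (le_trans (ler_wpM2l (ltW wk0) DM))//.
by rewrite le_eqVlt; apply/orP; left; apply/eqP; field.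
Qed.

(** * Area and critical triangles *)

(** Critical triangles exist and have positive area, so [A] is the maximal area
    of inscribed triangles; the bound extends to degenerate and to negatively
    oriented triples, which is the form needed along the arcs. *)
Lemma critical_bound (R : realType) (K : set (R * R)) (A : R) :
  circle_of_critical_triangles K ->
  (forall x y z : R * R, critical_triangle K x y z -> triangle_area x y z = A) ->
  [/\ 0 < A, (exists x y z, critical_triangle K x y z) &
      forall x y z, boundary K x -> boundary K y -> boundary K z ->
        twice_signed_area x y z <= 2 * A].
Proof.
move=> circ areaA; have [x0 [y0 [z0 [crit _]]]] := circ 0.
have A0 : 0 < A by rewrite -(areaA _ _ _ crit); case: crit => -[].
split=> //; first by exists x0, y0, z0.
move=> x y z bx b_y bz; have [le0|gt0] := lerP (twice_signed_area x y z) 0.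
  by apply: le_trans le0 _; rewrite mulr_ge0// ltW.
have tE : triangle_area x y z = twice_signed_area x y z / 2.
  by rewrite triangle_areaE gtr0_norm.
have : triangle_area x y z <= A.
  rewrite -(areaA _ _ _ crit); apply: crit.2; split=> //.
  by rewrite tE divr_gt0.
by rewrite tE ler_pdivrMr// mulrC.
Qed.

Lemma closed_boundary_sub (R : realType) (K : set (R * R)) : closed K ->
  boundary K `<=` K.
Proof. by move=> /closure_id clK x [+ _]; rewrite -clK. Qed.

Unset Implicit Arguments.

Theorem corollary1 (R : realType) (K : set (R * R)) (A : R)
  (K_convex_domain : convex_domain K)
  (K_circle : circle_of_critical_triangles K)
  (A_area : forall x y z : R * R,
     critical_triangle K x y z -> triangle_area x y z = A) :
  (area K <= (4 * pi * A / Num.sqrt 27)%:E)%E /\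
  (area K = (4 * pi * A / Num.sqrt 27)%:E <-> ellipse K).
Proof.
have [A0 [x0 [y0 [z0 crit]]] bound] := critical_bound K_circle A_area.
have s0 := sqrt3_gt0 R; have s33 := sqrt3_sq R.
have sn : Num.sqrt 3 != 0 :> R := lt0r_neq0 s0.
have [c [w [f [g [w0 cf cg gf KE]]]]] := convex_domain_graphs K_convex_domain.
have wn := lt0r_neq0 w0.
(* The value of the sum of the heights times the sines for a triangle of
   area A. *)
pose M := 2 * A / (Num.sqrt 3 * w).
have M0 : 0 < M by rewrite divr_gt0 ?mulr_gt0.
have EM : Num.sqrt 3 * w * M = 2 * A by rewrite mulrC divfK// mulf_neq0.
have bP t := boundary_arc_point t w0 gf KE.
have ext s t u := bound _ _ _ (bP s) (bP t) (bP u).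
have [|le eq] := area_average (M := M) w0 cf cg gf KE.
  move=> t _; have := ext t (t + 2 * pi / 3) (t - 2 * pi / 3).
  by rewrite arc_triangle_area -EM ler_pM2l// mulr_gt0.
have EA : 2 * pi / 3 * w * M = 4 * pi * A / Num.sqrt 27.
  by rewrite sqrt27 /M; field; rewrite wn sn.
rewrite EA in le eq; split=> //; split.
  move=> /eq Tmax.
  have [|S [B trig]] := extremal_arcs_trigonometric w0 cf cg _ Tmax.
    by move=> s t u; rewrite EM; exact: ext.
  apply/ellipseP; exists c, (S / 3), w, (2 * M / 3), (2 * B / 3); split=> //.
    by rewrite divr_gt0// mulr_gt0.
  exact: (trigonometric_arcs_ellipse w0 M0 KE trig).
move=> /ellipseP[c' [d [v [k [m [v0 k0 KEl]]]]]].
have [f' [g' [cf' cg' gf' KE' Y']]] := sheared_ellipse_graphs c' d m v0 k0.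
rewrite -KEl in KE'.
have Tcst t : arc_height f' g' c' v t * sin t +
    arc_height f' g' c' v (t + 2 * pi / 3) * sin (t + 2 * pi / 3) +
    arc_height f' g' c' v (t - 2 * pi / 3) * sin (t - 2 * pi / 3) = 3 / 2 * k.
  rewrite !Y' cosD2pi3 sinD2pi3 cosB2pi3 sinB2pi3.
  have c2 := cos2sin2 t; rewrite expr2 in c2.
  by field: s33 c2.
have [|_ [_ areaE]] := area_average (M := 3 / 2 * k) v0 cf' cg' gf' KE'.
  by move=> t _; rewrite Tcst.
rewrite areaE; last by move=> t _; exact: Tcst.
have Ale : A <= 3 * Num.sqrt 3 / 4 * v * k.
  rewrite -(A_area _ _ _ crit).
  have bK : boundary K `<=` K.
    apply: closed_boundary_sub; apply: compact_closed; last by case: K_convex_domain.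
    exact: norm_hausdorff.
  case: crit => -[_ [/bK + /bK + /bK +]] _; rewrite KEl.
  exact: triangle_in_sheared_ellipse.
(* Each of the equal-area triangles with vertices at angles 2 pi / 3 apart is
   inscribed; take the one at angle 0. *)
have Age : 3 * Num.sqrt 3 / 4 * v * k <= A.
  have bP' t := boundary_arc_point t v0 gf' KE'.
  have := bound _ _ _ (bP' 0) (bP' (0 + 2 * pi / 3)) (bP' (0 - 2 * pi / 3)).
  rewrite arc_triangle_area Tcst => h; lra.
have -> : A = 3 * Num.sqrt 3 / 4 * v * k by apply/le_anti; rewrite Ale.
by congr (_%:E); rewrite sqrt27; field.
Qed.
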